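(* Let $q\geq 5$ be a prime power with $q\equiv 2\pmod 3$, $m=(q+1)/3$. Let $P=P_{(a,b)}\in\mathcal X_3(\mathbb F_{q^2})\setminus\mathcal O$ be a point such that $\alpha(P)^2-\alpha(P)+1=0$. Then $$H(P)=\langle q,\ q+1,\ (q-1)+i(q-2)\ \mid\ i=0,\ldots,m-2\rangle.$$
   Context: Let $q$ be a prime power with $q\equiv 2\pmod 3$ and put $m=(q+1)/3$. Let $\mathcal X_3$ be the nonsingular projective model (defined over $\mathbb F_{q^2}$) of the plane curve $y^{q+1}+x^{2m}+x^m=0$. Let $\mathcal O_0$ be the $m$ points of $\mathcal X_3$ centered at the singular point $(0,0)$ (zeros of $x$) and $\mathcal O_\infty$ the $m$ points over the point at infinity (poles of $x$). Every other point has affine coordinates $(a,b)$ with $a\neq0$ and is denoted $P_{(a,b)}$. Let $\mathcal O_m=\{P_{(a,0)}: a^m+1=0\}$ and $\mathcal O=\mathcal O_0\cup\mathcal O_\infty\cup\mathcal O_m$. For $P=P_{(a,b)}\notin\mathcal O$ define $\alpha(P)=a^m/(1+a^m)$. $\mathcal X_3(\mathbb F_{q^2})$ denotes the set of $\mathbb F_{q^2}$-rational points. $H(P)$ is the Weierstrass semigroup at $P$: the set of integers $n\ge0$ such that some function on $\mathcal X_3$ has pole divisor exactly $nP$; $\langle\cdot\rangle$ is the semigroup generated by the listed integers. *)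

(* Defs.v *)
From HB Require Import structures.
From mathcomp Require Import all_boot all_order all_algebra all_field.
Set Implicit Arguments. Unset Strict Implicit. Unset Printing Implicit Defensive.
Import Order.TTheory GRing.Theory Num.Theory.
Local Open Scope ring_scope.

Definition mq (q : nat) : nat := (q.+1 %/ 3)%N.

Definition ev2 (F K : fieldType) (iota : {rmorphism F -> K})
  (p : {poly {poly F}}) (x y : K) : K :=
  (map_poly (map_poly iota) p).[y%:P].[x].

Definition curve_function_field (F K : fieldType) (iota : {rmorphism F -> K})
  (q : nat) (x y : K) : Prop :=
  [/\ forall p : {poly F}, (map_poly iota p).[x] = 0 -> p = 0,
      y ^+ q.+1 + x ^+ (2 * mq q) + x ^+ mq q = 0
    & forall z : K, exists p r : {poly {poly F}},
        ev2 iota r x y != 0 /\ z = ev2 iota p x y / ev2 iota r x y].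

(* A place of K/F, given by its normalized discrete valuation v
   (v 0 = +oo is not represented; the value of v at 0 is irrelevant). *)
Definition is_place (F K : fieldType) (iota : {rmorphism F -> K})
  (v : K -> int) : Prop :=
  [/\ forall c : F, c != 0 -> v (iota c) = 0,
      forall f g : K, f != 0 -> g != 0 -> v (f * g) = v f + v g,
      forall f g : K, f != 0 -> g != 0 -> f + g != 0 ->
        (v f <= v (f + g)) || (v g <= v (f + g))
    & exists t : K, t != 0 /\ v t = 1].

Definition same_place (K : fieldType) (v w : K -> int) : Prop :=
  forall f : K, f != 0 -> v f = w f.

Definition in_weierstrass_semigroup (F K : fieldType) (iota : {rmorphism F -> K})
  (vP : K -> int) (n : nat) : Prop :=
  exists f : K, [/\ f != 0, vP f = - (n%:Z)
    & forall w : K -> int, is_place iota w -> ~ same_place vP w -> 0 <= w f].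

Definition in_semigroup (gens : seq nat) (n : nat) : Prop :=
  exists c : nat -> nat,
    n = (\sum_(i < size gens) c i * nth 0%N gens i)%N.

Definition gens4p4 (q : nat) : seq nat :=
  [:: q; q.+1] ++ [seq ((q - 1) + i * (q - 2))%N | i <- iota 0 (mq q - 1)].

(* Main.v *)
(** Put [X = x / a], [Y = y / b], [Z = Y ^ 3 / X] and [w = a ^ m], a primitive cube root of unity.
    The curve lies on the cubic surface [X Z = Y ^ 3], satisfies [w X ^ m + w ^ 2 Z ^ m + 1 = 0],
    and [P] is the point [(1, 1, 1)].  The tangent plane [h = X + Z + 1 - 3 Y] meets the curve
    only at [P], with multiplicity [q + 1], and it meets the cubic surface in a nodal cubic with
    node [P].  The curve osculates one branch of this cubic to order [q + 1]; with the parameter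
    [t] on the normalisation for which that branch is at [t = 0] and the other one at infinity,
    forms of degree [d] restrict to the polynomials of degree at most [3 d] whose extreme
    coefficients are glued.  The forms restricting to [t ^ (3 d - 1)], divided by [h ^ d], have
    the pole orders [(q - 1) + (d - 1) (q - 2)] at [P] and no other pole.

    The semigroup so generated is symmetric with largest gap [(m - 1) (q + 1) + 1], hence it is
    enough to exclude this pole order.  If [f] had it, the differential
    [f h ^ (m - 1) x ^ (m - 1) dx / y ^ q] would have a single, simple pole, against the residue
    theorem.  The residue theorem is replaced by the trace to [F(x)]: the trace of
    [f h ^ (m - 1) x ^ (m - 1) (x - 1) / y ^ q] over the automorphisms [y -> zeta y] is a rational
    function of [x] without poles and vanishing at infinity, so it is zero, but it is a unit at
    [P].  This uses the existence of places over a given irreducible polynomial, which comes from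
    a maximal subring (Zorn) that is a valuation ring, discrete because [K] is finite over
    [F(x)]. *)
Require Import Defs.
From HB Require Import structures.
From mathcomp Require Import all_boot all_order all_algebra all_field.
From mathcomp Require Import cyclic boolp classical_sets zify ring.

Set Implicit Arguments. Unset Strict Implicit. Unset Printing Implicit Defensive.
Import Order.TTheory GRing.Theory Num.Theory.
Local Open Scope ring_scope.

(** * Valuation rings *)

Section ValuationRings.
Variable K : fieldType.
Implicit Types (S T : K -> Prop) (u v z t : K).

Definition ring_set S :=
  [/\ S 1, forall u v, S u -> S v -> S (u - v) & forall u v, S u -> S v -> S (u * v)].

Definition vring S := ring_set S /\ forall u, u != 0 -> S u \/ S u^-1.

Section RingSetTheory.
Variables (S : K -> Prop) (ringS : ring_set S).

Lemma ring_set1 : S 1. Proof. by case: ringS. Qed.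
Lemma ring_setB u v : S u -> S v -> S (u - v).
Proof. by case: ringS => _ SB _; apply: SB. Qed.
Lemma ring_setM u v : S u -> S v -> S (u * v).
Proof. by case: ringS => _ _ SM; apply: SM. Qed.
Lemma ring_set0 : S 0.
Proof. by have -> : 0 = 1 - 1 :> K; [rewrite subrr | apply: ring_setB; apply: ring_set1]. Qed.
Lemma ring_setD u v : S u -> S v -> S (u + v).
Proof.
move=> Su Sv; rewrite -[v]opprK; apply: ring_setB => //.
by rewrite -sub0r; apply: ring_setB => //; apply: ring_set0.
Qed.
Lemma ring_set_sum (I : Type) (r : seq I) (P : pred I) (E : I -> K) :
  (forall i, P i -> S (E i)) -> S (\sum_(i <- r | P i) E i).
Proof. by move=> SE; elim/big_ind: _; [apply: ring_set0 | apply: ring_setD |]. Qed.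
Lemma ring_setX u n : S u -> S (u ^+ n).
Proof.
move=> Su; elim: n => [|n IHn]; first by rewrite expr0; apply: ring_set1.
by rewrite exprS; apply: ring_setM.
Qed.

Definition adjoin u w := exists p : {poly K}, (forall i, S p`_i) /\ w = p.[u].

Lemma adjoin_ring u : ring_set (adjoin u).
Proof.
split=> [|v w [p [Sp ->]] [r [Sr ->]]|v w [p [Sp ->]] [r [Sr ->]]].
- exists 1; split=> [i|]; last by rewrite hornerC.
  by rewrite coef1; case: (i == _); [apply: ring_set1 | apply: ring_set0].
- by exists (p - r); rewrite hornerD hornerN; split=> // i; rewrite coefB; apply: ring_setB.
- exists (p * r); rewrite hornerM; split=> // i; rewrite coefM.
  by apply: ring_set_sum => j _; apply: ring_setM.
Qed.

Lemma sub_adjoin u w : S w -> adjoin u w.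
Proof.
move=> Sw; exists w%:P; rewrite hornerC; split=> // i.
by rewrite coefC; case: (i == _) => //; apply: ring_set0.
Qed.

Lemma adjoin_gen u : adjoin u u.
Proof.
exists 'X; rewrite hornerX; split=> // i.
by rewrite coefX; case: (i == _); [apply: ring_set1 | apply: ring_set0].
Qed.

(** An equation making [z] invertible in the ring generated by [S] and [u], graded by the degree in
    [u] so that this degree can be lowered. *)
Definition unit_rel z u n :=
  exists c : nat -> K, (forall i, S (c i)) /\ z * \sum_(i < n.+1) c i * u ^+ i = 1.

(** Multiplied by [u ^ (n + 1)], the relation in [u^-1] expresses [(1 - z b_0) u ^ (n + 1)] through
    lower powers of [u]. This eliminates the leading term of the relation in [u] multiplied by
    [1 - z b_0]; adding [z b_0] restores the right-hand side 1. *)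
Lemma unit_rel_lower z u n : S z -> u != 0 ->
  unit_rel z u n.+1 -> unit_rel z u^-1 n.+1 -> unit_rel z u n.
Proof.
move=> Sz u0 [c [Sc Hc]] [b [Sb Hb]].
pose c' i := (i == 0%N)%:R * b 0%N + (1 - z * b 0%N) * c i + c n.+1 * z * b (n.+1 - i)%N.
exists c'; split.
  move=> i; apply: ring_setD; first apply: ring_setD; last by do 2?apply: ring_setM.
    apply: ring_setM => //.
    by case: (i == _); [apply: ring_set1 | apply: ring_set0].
  apply: ring_setM => //; apply: ring_setB; first exact: ring_set1.
  exact: ring_setM.
have -> : \sum_(i < n.+1) c' i * u ^+ i = b 0%N + (1 - z * b 0%N) * (\sum_(i < n.+1) c i * u ^+ i)
   + c n.+1 * z * (\sum_(i < n.+1) b (n.+1 - i)%N * u ^+ i).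
  rewrite !big_distrr /=.
  have EB : b 0%N = \sum_(i < n.+1) (i == 0 :> nat)%:R * b 0%N * u ^+ i.
    rewrite big_ord_recl /= mul1r expr0 mulr1 big1 ?addr0 // => i _.
    by rewrite !mul0r.
  rewrite [X in X + _ + _]EB -!big_split /=; apply: eq_bigr => i _.
  by rewrite /c' !mulrDl !mulrA.
have E1 : z * \sum_(i < n.+1) c i * u ^+ i = 1 - z * (c n.+1 * u ^+ n.+1).
  by rewrite -Hc [in RHS]big_ord_recr /= mulrDr addrK.
have E2 : z * \sum_(i < n.+1) b (n.+1 - i)%N * u ^+ i = u ^+ n.+1 * (1 - z * b 0%N).
  have -> : 1 - z * b 0%N = z * \sum_(i < n.+1) b i.+1 * u^-1 ^+ i.+1.
    by rewrite -Hb big_ord_recl /= expr0 mulr1 mulrDr addrC addKr.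
  rewrite mulrCA; congr (_ * _); rewrite big_distrr (reindex_inj rev_ord_inj) /=.
  apply: eq_bigr => i _; have := ltn_ord i; rewrite ltnS => le_in.
  rewrite (_ : n.+1 - (n.+1 - i.+1) = i.+1)%N; last by lia.
  rewrite mulrCA; congr (_ * _); apply: (mulIf (expf_neq0 i.+1 u0)).
  by rewrite -exprD -mulrA -exprMn mulVf // expr1n mulr1; congr (_ ^+ _); lia.
have -> : z * (b 0%N + (1 - z * b 0%N) * \sum_(i < n.+1) c i * u ^+ i +
    c n.+1 * z * \sum_(i < n.+1) b (n.+1 - i)%N * u ^+ i) =
  z * b 0%N + (1 - z * b 0%N) * (z * \sum_(i < n.+1) c i * u ^+ i) +
    c n.+1 * z * (z * \sum_(i < n.+1) b (n.+1 - i)%N * u ^+ i) by ring.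
by rewrite E1 E2; ring.
Qed.

(** By symmetry both degrees drop together down to 0, where the relation puts [z^-1] into [S]. *)
Lemma unit_rel_absurd z u n : S z -> ~ S z^-1 -> u != 0 ->
  unit_rel z u n -> unit_rel z u^-1 n -> False.
Proof.
move=> Sz Sz' u0; elim: n => [|n IHn] Hu Hv.
  case: Hu => c [Sc]; rewrite big_ord1 expr0 mulr1 => Hc; apply: Sz'.
  suff -> : z^-1 = c 0%N by [].
  have z0 : z != 0 by apply: contra_eq_neq Hc => ->; rewrite mul0r eq_sym oner_eq0.
  by rewrite -[LHS]mulr1 -Hc mulKf.
apply: IHn; apply: unit_rel_lower; rewrite ?invr_eq0 ?invrK //.
Qed.

Lemma unit_rel_widen z u n k : (n <= k)%N -> unit_rel z u n -> unit_rel z u k.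
Proof.
move=> le_nk [c [Sc Hc]].
exists (fun i => if (i < n.+1)%N then c i else 0); split.
  by move=> i; case: ifP => // _; apply: ring_set0.
rewrite -Hc; congr (_ * _); rewrite [RHS](big_ord_widen k.+1 (fun i => c i * u ^+ i)) //.
by rewrite [RHS]big_mkcond; apply: eq_bigr => i _; case: ifP; rewrite ?mul0r.
Qed.

Lemma adjoin_unit_rel z u : z != 0 -> adjoin u z^-1 -> exists n, unit_rel z u n.
Proof.
move=> z0 [p [Sp Hp]]; exists (size p); exists (fun i => p`_i); split => //.
by rewrite -(horner_coef_wide u (leqnSn (size p))) -Hp mulfV.
Qed.

End RingSetTheory.

(** Take a subring over [T] that is maximal for not containing [z^-1]. If it contained neither [u]
    nor [u^-1], adjoining either of them would produce [z^-1], hence the two incompatible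
    relations. *)
Lemma exists_vring T z : ring_set T -> T z -> ~ T z^-1 ->
  exists S, [/\ vring S, forall u, T u -> S u & ~ S z^-1].
Proof.
move=> ringT Tz Tz'.
pose good (S : set K) := [/\ ring_set S, forall u, T u -> S u & ~ S z^-1].
pose P (S : set K) := S = set0 \/ good S.
have [|S [PS maxS]] := @Zorn_bigcup K P.
  move=> C PC totC.
  have [nilC|/existsNP[S0 /not_implyP[CS0 S0n]]] := pselect (forall S, C S -> S = set0).
    by left; apply/seteqP; split=> u //= [S CS]; rewrite (nilC S CS).
  have gS0 : good S0 by case: (PC _ CS0).
  have big2 u v : (\bigcup_(X in C) X)%classic u -> (\bigcup_(X in C) X)%classic v ->
     exists S, [/\ C S, good S, S u & S v].
    move=> [A CA Au] [B CB Bv].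
    have [sAB|sBA] := totC A B CA CB.
      exists B; split=> //; last exact: sAB.
      by case: (PC _ CB) => // B0; rewrite B0 in Bv.
    exists A; split=> //; last exact: sBA.
    by case: (PC _ CA) => // A0; rewrite A0 in Au.
  right; split; first split.
  - by exists S0 => //; apply: ring_set1; case: gS0.
  - move=> u v Cu Cv; have [S [CS gS Su Sv]] := big2 _ _ Cu Cv.
    by exists S => //; apply: ring_setB; case: gS.
  - move=> u v Cu Cv; have [S [CS gS Su Sv]] := big2 _ _ Cu Cv.
    by exists S => //; apply: ring_setM; case: gS.
  - by move=> u Tu; exists S0 => //; case: gS0 => _ sT _; apply: sT.
  - by move=> Cz; have [S [_ [_ _]]] := big2 _ _ Cz Cz.
have gS : good S.
  case: PS => // S0; have [|] := maxS T; last by right; split.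
    by rewrite S0; split=> // sT; apply: (sT z).
have [ringS sTS Sz'] := gS.
exists S; split=> //; split=> // u u0.
have z0 : z != 0 by apply: contra_notN Tz' => /eqP->; rewrite invr0; apply: ring_set0.
have ext w : ~ S w -> adjoin S w z^-1.
  move=> Sw; apply: contrapT => nz.
  have [|] := maxS (adjoin S w).
    split; first by move=> v; apply: sub_adjoin.
    by move=> s; apply: Sw; apply: s; apply: adjoin_gen.
  right; split=> //; first exact: adjoin_ring.
  by move=> v Tv; apply: sub_adjoin => //; apply: sTS.
apply: contrapT => /not_orP[/ext/(adjoin_unit_rel z0)[n Hn]].
move=> /ext/(adjoin_unit_rel z0)[k Hk].
have Sz := sTS _ Tz.
apply: (@unit_rel_absurd S ringS z u (maxn n k)) => //.
  by apply: unit_rel_widen Hn; rewrite ?leq_maxl.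
by apply: unit_rel_widen Hk; rewrite ?leq_maxr.
Qed.

End ValuationRings.

(** * Maximal ideal and units of a valuation ring *)

Section MaximalIdeal.
Variables (K : fieldType) (S : K -> Prop) (vringS : vring S).
Implicit Types (u v t : K).

Let ringS : ring_set S. Proof. by case: vringS. Qed.

(** Zero is listed apart because [0^-1 = 0] lies in [S]. *)
Definition maxid u := u = 0 \/ ~ S u^-1.

Definition vunit u := [/\ u != 0, S u & S u^-1].

Lemma maxid0 : maxid 0. Proof. by left. Qed.

Lemma maxidW u : maxid u -> S u.
Proof.
case=> [->|Su]; first exact: ring_set0.
have [->|u0] := eqVneq u 0; first exact: ring_set0.
by have [_ /(_ u u0)[]] := vringS.
Qed.

Lemma maxid1 : ~ maxid 1.
Proof. by case=> [/eqP|]; [rewrite oner_eq0 | rewrite invr1; apply; apply: ring_set1]. Qed.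

Lemma maxidMr u v : S u -> maxid v -> maxid (u * v).
Proof.
move=> Su [->|Sv]; first by rewrite mulr0; left.
have [->|u0] := eqVneq u 0; first by rewrite mul0r; left.
by right; apply: contra_not Sv => Suv; rewrite -(mulVKf u0 v^-1) -invfM; apply: ring_setM.
Qed.

Lemma maxidMl u v : maxid u -> S v -> maxid (u * v).
Proof. by move=> Mu Sv; rewrite mulrC; apply: maxidMr. Qed.

Lemma maxidN u : maxid u -> maxid (- u).
Proof.
by move=> Mu; rewrite -mulN1r; apply: maxidMr => //; rewrite -sub0r; apply: ring_setB => //;
  [apply: ring_set0 | apply: ring_set1].
Qed.

Lemma maxidD u v : maxid u -> maxid v -> maxid (u + v).
Proof.
wlog Suv : u v / S (u / v) => [hwlog|].
  have [->|u0] := eqVneq u 0; first by rewrite add0r.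
  have [->|v0] := eqVneq v 0; first by rewrite addr0.
  have [|Suv|Suv] := vringS.2 (u / v); first by rewrite mulf_neq0 ?invr_eq0.
    exact: hwlog.
  by move=> Mu Mv; rewrite addrC; apply: hwlog => //; rewrite -invf_div.
have [->|v0] := eqVneq v 0; first by rewrite addr0.
move=> Mu Mv; rewrite (_ : u + v = (u / v + 1) * v); last by rewrite mulrDl divfK ?mul1r.
by apply: maxidMr => //; apply: ring_setD => //; apply: ring_set1.
Qed.

Lemma maxidB u v : maxid u -> maxid v -> maxid (u - v).
Proof. by move=> Mu Mv; apply: maxidD => //; apply: maxidN. Qed.

Lemma maxid_sum (I : Type) (r : seq I) (P : pred I) (E : I -> K) :
  (forall i, P i -> maxid (E i)) -> maxid (\sum_(i <- r | P i) E i).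
Proof. by move=> ME; elim/big_ind: _; [apply: maxid0 | apply: maxidD |]. Qed.

Lemma vunitP u : S u -> ~ maxid u -> vunit u.
Proof.
move=> Su /not_orP[/eqP u0 /contrapT Su']; split=> //.
Qed.

Lemma maxid_vunit u : maxid u -> ~ vunit u.
Proof. by case=> [->|Su] [] //; rewrite eqxx. Qed.

Lemma vunitM u v : vunit u -> vunit v -> vunit (u * v).
Proof.
by move=> [u0 Su Su'] [v0 Sv Sv']; split; rewrite ?mulf_neq0 // ?invfM; apply: ring_setM.
Qed.

Lemma vunitV u : vunit u -> vunit u^-1.
Proof. by case=> u0 Su Su'; split; rewrite ?invr_eq0 ?invrK. Qed.

Lemma vunit1 : vunit 1.
Proof. by split; rewrite ?invr1 ?oner_eq0 //; apply: ring_set1. Qed.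

Lemma vunitX u n : vunit u -> vunit (u ^+ n).
Proof.
move=> Uu; elim: n => [|n IHn]; first by rewrite expr0; apply: vunit1.
by rewrite exprS; apply: vunitM.
Qed.

Lemma maxid_prime u v : S u -> S v -> maxid (u * v) -> maxid u \/ maxid v.
Proof.
move=> Su Sv Muv; have [|/vunitP Uu] := pselect (maxid u); first by left.
right; apply: contrapT => /vunitP Uv; apply: maxid_vunit Muv _.
by apply: vunitM; [apply: Uu | apply: Uv].
Qed.

Lemma maxid_primeX u n : S u -> maxid (u ^+ n) -> maxid u.
Proof.
move=> Su; elim: n => [|n IHn]; first by rewrite expr0 => /maxid1.
by rewrite exprS => /maxid_prime[] //; apply: ring_setX.
Qed.

(** Divisibility in a valuation ring is total. The member that divides all others stands for a term
    of least value at a stage where no integer values exist yet. *)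
Lemma exists_dominant (I : eqType) (s : seq I) (E : I -> K) i0 : i0 \in s -> E i0 != 0 ->
  exists i, [/\ i \in s, E i != 0 & forall j, j \in s -> S (E j / E i)].
Proof.
have S00 (v : K) : S (0 / v) by rewrite mul0r; apply: ring_set0.
elim: s i0 => // k s IHs i0; rewrite inE => i0s Ei0.
have [[j js Ej]|noE] := pselect (exists2 j, j \in s & E j != 0); last first.
  have Ek : E k != 0.
    by case/predU1P: i0s => [<-//|i0s]; case: noE; exists i0.
  exists k; split=> //; first by rewrite mem_head.
  move=> j; rewrite inE => /predU1P[->|js]; first by rewrite divff //; apply: ring_set1.
  have [->//|Ej] := eqVneq (E j) 0; by case: noE; exists j.
have [i [is_ Ei Hi]] := IHs j js Ej.
have [Ek|Ek] := eqVneq (E k) 0.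
  exists i; split=> //; first by rewrite inE is_ orbT.
  by move=> l; rewrite inE => /predU1P[->|/Hi//]; rewrite Ek.
have [|Ski|Sik] := vringS.2 (E k / E i); first by rewrite mulf_neq0 ?invr_eq0.
  exists i; split=> //; first by rewrite inE is_ orbT.
  by move=> l; rewrite inE => /predU1P[->|/Hi].
exists k; split=> //; first exact: mem_head.
move=> l; rewrite inE => /predU1P[->|/Hi Sl]; first by rewrite divff //; apply: ring_set1.
rewrite (_ : E l / E k = (E l / E i) * (E k / E i)^-1); first exact: ring_setM.
by rewrite invf_div mulrA divfK.
Qed.

(** If the dominant term strictly dominated all the others, dividing the sum by it would put 1 into
    the maximal ideal. *)
Lemma sum_eq0_vunit (I : finType) (E : I -> K) i0 : \sum_i E i = 0 -> E i0 != 0 ->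
  exists i j, [/\ i != j, E i != 0, E j != 0 & vunit (E i / E j)].
Proof.
move=> E0 Ei0; have [j [_ Ej Hj]] := exists_dominant (mem_enum I i0) Ei0.
have {}Hj i : S (E i / E j) by apply: Hj; rewrite mem_enum.
apply: contrapT => no; apply: maxid1.
have -> : 1 = - \sum_(i | i != j) E i / E j.
  move/eqP: E0; rewrite (bigD1 j) //= addr_eq0 => /eqP E0.
  by rewrite -mulr_suml -mulNr -E0 divff.
apply/maxidN/maxid_sum => i ij; apply: contrapT => Mij; apply: no.
have Uij := vunitP (Hj i) Mij.
exists i, j; split=> //; have [+ _ _] := Uij.
by apply: contra_neq => ->; rewrite mul0r.
Qed.

End MaximalIdeal.

(** * Existence of places *)

Section Discrete.
Variables (F K : fieldType) (iota : {rmorphism F -> K}) (x : K) (S : K -> Prop).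
Hypothesis vringS : vring S.
Hypothesis S_iota : forall c, S (iota c).
Hypothesis Sx : S x.
Notation evx f := (map_poly iota f).[x].
Variable pi : {poly F}.
Hypothesis irr_pi : irreducible_poly pi.
Hypothesis pi_maxid : maxid S (evx pi).
Hypothesis evx_neq0 : forall f : {poly F}, f != 0 -> evx f != 0.
Variable n : nat.
Hypothesis dep : forall u : 'I_n.+1 -> K, exists f : 'I_n.+1 -> {poly F},
  (exists i, f i != 0) /\ \sum_i evx (f i) * u i = 0.

Let ringS : ring_set S. Proof. by case: vringS. Qed.

Lemma S_evx f : S (evx f).
Proof.
rewrite horner_coef; apply: ring_set_sum => // i _; apply: ring_setM => //.
  by rewrite coef_map; apply: S_iota.
exact: ring_setX.
Qed.

(** By Bezout 1 is a combination of [pi] and [f], so they are not both in the maximal ideal. *)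
Lemma vunit_coprime f : ~~ (pi %| f) -> vunit S (evx f).
Proof.
rewrite -irreducible_poly_coprime // => /Bezout_eq1_coprimepP[[u v] /= uv1].
apply: vunitP => // [|Mf]; first exact: S_evx.
apply: (maxid1 vringS); have <- : evx (u * pi + v * f) = 1.
  by rewrite uv1 rmorph1 hornerC.
rewrite rmorphD !rmorphM hornerD !hornerM.
by apply: maxidD => //; apply: maxidMr => //; apply: S_evx.
Qed.

Lemma evx_pi_unit f : f != 0 -> exists k u, vunit S u /\ evx f = evx pi ^+ k * u.
Proof.
have [m] := ubnP (size f); elim: m f => // m IHm f le_f_m f0.
have [/dvdpP[g fE]|ndvd] := boolP (pi %| f); last first.
  by exists 0%N, (evx f); rewrite expr0 mul1r; split=> //; apply: vunit_coprime.
have g0 : g != 0 by apply: contra_neq f0 => g0; rewrite fE g0 mul0r.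
have [|k [u [Uu gE]]] := IHm g _ g0.
  move: le_f_m; rewrite fE size_mul ?(irredp_neq0 irr_pi) //.
  by move: irr_pi.1; move: (size pi) (size g) => [|[|a]] b //; rewrite addnS /=; lia.
exists k.+1, u; split=> //.
by rewrite fE rmorphM hornerM gE exprS; ring.
Qed.

Lemma pi_neq0 : evx pi != 0. Proof. exact/evx_neq0/irredp_neq0. Qed.

(* The values of the [E i] would be distinct modulo the value of [pi], making
   the [E i] independent over the rational functions in [x]. *)
Lemma chain_bound (E : 'I_n.+1 -> K) : (forall i, E i != 0) -> (forall i, S (E i)) ->
  (forall i, maxid S (evx pi / E i)) ->
  ~ (forall i j, i != j -> ~ vunit S (E i / E j)).
Proof.
move=> E0 SE piE nU.
(* For equal exponents this is [nU]; otherwise the inverse quotient has the factor [evx pi / E i],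
   which lies in the maximal ideal. *)
have nU2 i j ki kj ui uj : (ki <= kj)%N -> i != j -> vunit S ui -> vunit S uj ->
    ~ vunit S (evx pi ^+ ki * ui * E i / (evx pi ^+ kj * uj * E j)).
  move=> le_k ij Ui Uj Uij; have [ui0 _ _] := Ui; have [uj0 _ _] := Uj.
  have Uji : vunit S (evx pi ^+ (kj - ki) * (E j / E i)).
    rewrite (_ : _ * _ = (evx pi ^+ ki * ui * E i / (evx pi ^+ kj * uj * E j))^-1 * (ui / uj)).
      by apply: vunitM => //; [apply: vunitV | apply: vunitM => //; apply: vunitV].
    have Epi : evx pi ^+ kj = evx pi ^+ ki * evx pi ^+ (kj - ki) by rewrite -exprD subnKC.
    rewrite Epi; have := expf_neq0 ki pi_neq0; have := expf_neq0 (kj - ki) pi_neq0.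
    move: (evx pi ^+ ki) (evx pi ^+ (kj - ki)) (E0 i) (E0 j) => A B Ei Ej B0 A0.
    by field; rewrite A0 B0 Ei Ej ui0 uj0.
  case: (kj - ki)%N Uji => [|k]; first by rewrite expr0 mul1r; apply: nU; rewrite eq_sym.
  apply: maxid_vunit => //; rewrite (_ : _ * _ = evx pi ^+ k * E j * (evx pi / E i)); last first.
    by rewrite exprSr; ring.
  by apply: maxidMr => //; apply: ring_setM => //; apply: ring_setX => //; apply: S_evx.
have [f [[i0 fi0] sum0]] := dep E.
have fE0 : evx (f i0) * E i0 != 0 by rewrite mulf_neq0 ?evx_neq0.
have [i [j [ij fi fj]]] := sum_eq0_vunit vringS sum0 fE0.
have {}fi : f i != 0 by apply: contra_neq fi => ->; rewrite rmorph0 horner0 mul0r.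
have {}fj : f j != 0 by apply: contra_neq fj => ->; rewrite rmorph0 horner0 mul0r.
have [ki [ui [Ui ->]]] := evx_pi_unit fi; have [kj [uj [Uj ->]]] := evx_pi_unit fj.
have [le_k|/ltnW le_k] := leqP ki kj; first exact: nU2.
by move/vunitV; rewrite invf_div; apply: nU2 => //; rewrite eq_sym.
Qed.

(** If the maximal ideal had no generator, each of its nonzero elements would be a proper multiple
    of another one. Starting from [pi], this gives an infinite chain of elements with distinct
    values, against [chain_bound]. *)
Lemma exists_uniformizer : exists2 t, t != 0 /\ maxid S t &
  forall u, maxid S u -> S (u / t).
Proof.
apply: contrapT => no.
have next (t : K) : exists u, t != 0 -> maxid S t -> [/\ u != 0, maxid S u & maxid S (t / u)].
  have [[t0 Mt]|nt] := pselect (t != 0 /\ maxid S t); last by exists 0 => t0 Mt; case: nt.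
  apply: contrapT => no2; apply: no; exists t => // u Mu; apply: contrapT => Sut.
  apply: no2; exists u => _ _; split=> //.
    by apply: contra_notN Sut => /eqP->; rewrite mul0r; apply: ring_set0.
  by right; rewrite invf_div.
have [g Hg] := choice next.
pose c i := iter i g (evx pi).
have Hc i : c i != 0 /\ maxid S (c i).
  elim: i => [|i [c0 Mc]]; first by split; [apply: pi_neq0|].
  by have [] := Hg (c i) c0 Mc.
have Hcc i k : maxid S (c i / c (i + k.+1)%N).
  elim: k => [|k IHk]; rewrite addnS.
    by have [c0 Mc] := Hc i; have [_ _] := Hg _ c0 Mc; rewrite addn0.
  have [c0' Mc' Mcc] := Hg _ (Hc (i + k.+1)%N).1 (Hc (i + k.+1)%N).2.
  rewrite (_ : _ / _ = (c i / c (i + k.+1)%N) * (c (i + k.+1)%N / g (c (i + k.+1)%N))).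
    by apply: maxidMr => //; apply: maxidW.
  by rewrite mulrA divfK //; have [] := Hc (i + k.+1)%N.
apply: (@chain_bound (fun i => c i.+1)) => [i|i|i|i j].
- by have [] := Hc i.+1.
- by apply: maxidW => //; have [] := Hc i.+1.
- by have := Hcc 0%N i; rewrite add0n.
wlog lt_ij : i j / (i < j)%N => [hwlog ij|_].
  have [lt_ij|lt_ji|eq_ij] := ltngtP i j; first exact: hwlog.
    by move/vunitV; rewrite invf_div; apply: hwlog; rewrite // eq_sym.
  by case/eqP: ij; apply: val_inj.
by have := Hcc i.+1 (j - i).-1; rewrite (_ : i.+1 + _ = j.+1)%N; [apply: maxid_vunit | lia].
Qed.

(** The point is that no nonzero element of [S] is divisible by all powers of [t]. For [pi] this is
    [chain_bound] on the powers of [t]; it passes to polynomials in [x] by [evx_pi_unit], and to any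
    [u] in [S] because [u] divides a nonzero polynomial in [x]. *)
Lemma exists_discrete_valuation : exists t, [/\ t != 0, maxid S t &
  forall u, u != 0 -> exists k : int, vunit S (u / t ^ k)].
Proof.
have [t [t0 Mt] Ht] := exists_uniformizer.
exists t; split=> //.
have tX0 k : t ^+ k != 0 by rewrite expf_neq0.
have St := maxidW vringS Mt.
have pi_fin : exists k, ~ S (evx pi / t ^+ k).
  apply: contrapT => no.
  have {}no k : S (evx pi / t ^+ k) by apply: contrapT => nk; apply: no; exists k.
  apply: (@chain_bound (fun i => t ^+ i)) => [i|i|i|i j] //.
  - exact: ring_setX.
  - rewrite (_ : _ / _ = t * (evx pi / t ^+ i.+1)); first exact: maxidMl.
    by rewrite exprSr; have := tX0 i; move: (t ^+ i) => B B0; field; rewrite t0 B0.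
  wlog lt_ij : i j / (i < j)%N => [hwlog ij|_].
    have [lt_ij|lt_ji|eq_ij] := ltngtP i j; first exact: hwlog.
      by move/vunitV; rewrite invf_div; apply: hwlog; rewrite // eq_sym.
    by case/eqP: ij; apply: val_inj.
  move/vunitV; rewrite invf_div -expfB // -(prednK (n := j - i)) ?subn_gt0 // exprS.
  by apply: maxid_vunit; apply: maxidMl => //; apply: ring_setX.
have exact_value u : S u -> u != 0 -> (exists k, ~ S (u / t ^+ k)) ->
    exists k, vunit S (u / t ^+ k).
  move=> Su u0 ex_k.
  have ex_k' : exists k, `[< ~ S (u / t ^+ k) >] by case: ex_k => k /asboolP; exists k.
  case: (ex_minnP ex_k') => [[|k]] /asboolP nS mink; first by case: nS; rewrite expr0 divr1.
  exists k; apply: vunitP => // [|Muk].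
    by apply: contrapT => /asboolP /mink; rewrite ltnn.
  by apply: nS; rewrite exprSr invfM mulrA; apply: Ht.
have [e Ue] := exact_value _ (S_evx pi) pi_neq0 pi_fin.
have evx_fin f : f != 0 -> exists k, ~ S (evx f / t ^+ k).
  move=> f0; have [k [u [Uu fE]]] := evx_pi_unit f0.
  exists (e * k).+1; rewrite fE => nS.
  have U : vunit S (evx pi ^+ k * u / t ^+ (e * k)).
    rewrite mulrAC exprM -expr_div_n; apply: vunitM => //; exact: vunitX.
  apply: (maxid_vunit _ U) => //; move: nS; rewrite exprSr invfM mulrA => nS.
  by rewrite -(divfK t0 (_ / _)); apply: maxidMr.
have fin u : S u -> u != 0 -> exists k, ~ S (u / t ^+ k).
  move=> Su u0; have [f [[i0 fi0] sum0]] := dep (fun i => u ^+ i).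
  have ex_i : exists i, (i < n.+1)%N && (f (inord i) != 0).
    by exists i0; rewrite ltn_ord inord_val.
  case: (ex_minnP ex_i) => i /andP[lt_in fi] mini.
  have [k nk] := evx_fin _ fi; exists k; apply: contra_not nk => Suk.
  pose i1 : 'I_n.+1 := inord i.
  have Ei1 : i1 = i :> nat by rewrite inordK.
  (* Dividing the relation between the powers of [u] by [u ^ i], where [i] is the lowest index with
     a nonzero coefficient, exhibits that coefficient as a multiple of [u]. *)
  suff -> : evx (f i1) / t ^+ k = - (\sum_(j | j != i1) if (j < i)%N then 0 else
       evx (f j) * u ^+ (j - i).-1) * (u / t ^+ k).
    apply: ring_setM => //; rewrite -sub0r; apply: ring_setB => //; first exact: ring_set0.
    apply: ring_set_sum => // j _; case: ifP => _; first exact: ring_set0.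
    by apply: ring_setM => //; [apply: S_evx | apply: ring_setX].
  rewrite mulrA; congr (_ / _); apply: (mulIf (expf_neq0 i u0)).
  move/eqP: sum0; rewrite (bigD1 i1) //= Ei1 addr_eq0 => /eqP->.
  rewrite !mulNr; congr (- _); rewrite -mulrA -exprS mulr_suml.
  apply: eq_bigr => j ji; case: ltnP => [lt_ji|le_ij].
    suff -> : f j = 0 by rewrite rmorph0 horner0 !mul0r.
    apply/eqP; apply: contraTT lt_ji => fj; rewrite -leqNgt mini //.
    by rewrite ltn_ord inord_val.
  rewrite -mulrA -exprD; congr (_ * _ ^+ _).
  have : (i != j)%N by apply: contra_neqN ji => /eqP ij; apply: val_inj; rewrite /= -ij -Ei1.
  by move: le_ij; lia.
move=> u u0; have [Su|Su] := vringS.2 u u0.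
  by have [k Uk] := exact_value u Su u0 (fin u Su u0); exists k%:Z.
have u'0 : u^-1 != 0 by rewrite invr_eq0.
have [k Uk] := exact_value _ Su u'0 (fin _ Su u'0).
by exists (- k%:Z); rewrite -exprnN invrK; have := vunitV Uk; rewrite invfM !invrK.
Qed.

Lemma exists_place_vring : exists w : K -> int, is_place iota w /\
  forall u, maxid S u -> u != 0 -> 0 < w u.
Proof.
have [t [t0 Mt Ht]] := exists_discrete_valuation.
have Ht' u : exists k : int, u != 0 -> vunit S (u / t ^ k).
  have [u0|u0] := boolP (u != 0); last by exists 0.
  by have [k Hk] := Ht u u0; exists k.
have [w Hw] := choice Ht'.
have St := maxidW vringS Mt.
have pos k : maxid S (t ^ k) -> 0 < k.
  case: k => [[|k]|k] //; first by move/(maxid1 vringS).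
  move=> Mk; exfalso; apply: (maxid1 vringS).
  rewrite (_ : 1 = t ^ Negz k * t ^+ k.+1); last by rewrite NegzE -exprnN mulVf ?expf_neq0.
  by apply: maxidMl => //; apply: ring_setX.
have posS k : 0 < k -> maxid S (t ^ k).
  by case: k => [[|k]|k] // _; rewrite -exprnP exprS; apply: maxidMl => //; apply: ring_setX.
have tE k : t ^ k != 0 by rewrite expfz_neq0.
have uniq u k : u != 0 -> vunit S (u / t ^ k) -> w u = k.
  move=> u0 Uk; have Ukk : vunit S (t ^ (w u - k)).
    rewrite (_ : t ^ _ = (u / t ^ k) * (u / t ^ w u)^-1).
      by apply: vunitM => //; apply: vunitV; apply: Hw.
    rewrite expfzDr // -invr_expz; have := tE k; have := tE (w u).
    by move: (t ^ k) (t ^ w u) => A B A0 B0; field; rewrite ?u0 ?A0 ?B0.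
  apply/eqP; rewrite -subr_eq0; have [lt0|gt0|//] := ltgtP (w u - k) 0.
    exfalso; apply: maxid_vunit (vunitV Ukk) => //; rewrite invr_expz; apply: posS.
    by rewrite oppr_gt0.
  by exfalso; apply: maxid_vunit Ukk => //; apply: posS.
have posE u : u != 0 -> maxid S u -> 0 < w u.
  move=> u0 Mu; apply: pos; rewrite (_ : t ^ w u = u * (u / t ^ w u)^-1).
    by apply: maxidMl => //; have [] := Hw u u0.
  by have := tE (w u); move: (t ^ w u) => A A0; field; rewrite ?u0 ?A0.
have nonneg u : u != 0 -> S u -> 0 <= w u.
  move=> u0 Su; have [Mu|/(vunitP Su) Uu] := pselect (maxid S u).
    exact/ltW/posE.
  by rewrite (uniq u 0) // expr0z divr1.
have wM u v : u != 0 -> v != 0 -> w (u * v) = w u + w v.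
  move=> u0 v0; apply: uniq; rewrite ?mulf_neq0 //.
  rewrite expfzDr // invfM mulrACA; apply: vunitM => //; exact: Hw.
have wV u : u != 0 -> w u^-1 = - w u.
  move=> u0; apply: uniq; rewrite ?invr_eq0 // -invr_expz -invfM; apply/vunitV.
  exact: Hw.
exists w; split; last by move=> u Mu u0; apply: posE.
split=> //.
- move=> c c0; apply: uniq; rewrite ?fmorph_eq0 // expr0z divr1; split=> //.
    by rewrite fmorph_eq0.
  by rewrite -fmorphV.
- move=> f g f0 g0 fg0; wlog Sfg : f g f0 g0 fg0 / S (f / g) => [hwlog|].
    have [|Sfg|Sgf] := vringS.2 (f / g); first by rewrite mulf_neq0 ?invr_eq0.
      exact: hwlog.
    by rewrite addrC orbC; apply: hwlog => //; [rewrite addrC | rewrite -invf_div].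
  apply/orP; right; rewrite -subr_ge0 -wV // -wM ?invr_eq0 //; apply: nonneg.
    by rewrite mulf_neq0 ?invr_eq0.
  by rewrite mulrDl divff //; apply: ring_setD => //; apply: ring_set1.
- exists t; split=> //; apply: uniq => //; rewrite expr1z divff //; exact: vunit1.
Qed.

End Discrete.

(** The valuation ring is grown from the polynomials in [x], where [pi] has no inverse for reasons
    of degree. It is discrete because any [n + 1] elements of [K] are dependent over these
    polynomials. *)
Lemma exists_place (F K : fieldType) (iota : {rmorphism F -> K}) (x : K) (n : nat)
    (pi : {poly F}) :
  (forall f : {poly F}, f != 0 -> (map_poly iota f).[x] != 0) ->
  (forall u : 'I_n.+1 -> K, exists f : 'I_n.+1 -> {poly F},
     (exists i, f i != 0) /\ \sum_i (map_poly iota (f i)).[x] * u i = 0) ->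
  irreducible_poly pi ->
  exists w : K -> int, is_place iota w /\ 0 < w (map_poly iota pi).[x].
Proof.
move=> tr dep irr.
pose T u := exists p : {poly F}, u = (map_poly iota p).[x].
have ringT : ring_set T.
  split=> [|_ _ [p ->] [r ->]|_ _ [p ->] [r ->]].
  - by exists 1; rewrite rmorph1 hornerC.
  - by exists (p - r); rewrite rmorphB hornerD hornerN.
  - by exists (p * r); rewrite rmorphM hornerM.
have pi0 := tr _ (irredp_neq0 irr).
have [||S [vringS TS npi]] := @exists_vring K T (map_poly iota pi).[x] ringT.
- by exists pi.
- case=> p Hp; have /eqP : (map_poly iota (pi * p - 1)).[x] = 0.
    by rewrite rmorphB rmorphM rmorph1 hornerD hornerN hornerM -Hp hornerC divff ?subrr.
  apply/negP/tr; rewrite subr_eq0; apply/eqP => pip.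
  have := size_poly1 F; rewrite -pip; have := irr.1 => sz.
  have p0 : p != 0 by apply/eqP => p0; move/eqP: pip; rewrite p0 mulr0 eq_sym oner_eq0.
  rewrite size_mul ?(irredp_neq0 irr) //.
  by move: p0 sz; rewrite -size_poly_gt0; case: (size pi) => [|[|?]] //; case: (size p) => [|?] //=;
    rewrite !addSn !addnS.
have Sc c : S (iota c) by apply: TS; exists c%:P; rewrite map_polyC hornerC.
have Sx : S x by apply: TS; exists 'X; rewrite map_polyX hornerX.
have [|w [plw Hw]] := @exists_place_vring F K iota x S vringS Sc Sx pi irr _ tr n dep.
  by right.
by exists w; split=> //; apply: Hw => //; right.
Qed.

(** * Calculus of valuations *)

Section PlaceTheory.
Variables (F K : fieldType) (iota : {rmorphism F -> K}) (v : K -> int).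
Hypothesis plv : is_place iota v.
Implicit Types (f g u w : K) (n m : int).

Lemma placeM f g : f != 0 -> g != 0 -> v (f * g) = v f + v g.
Proof. by case: plv => _ vM _ _; apply: vM. Qed.

Lemma place1 : v 1 = 0.
Proof.
have /esym/eqP := placeM (oner_neq0 K) (oner_neq0 K).
by rewrite mulr1 -subr_eq0 addrK => /eqP.
Qed.

Lemma placeV f : f != 0 -> v f^-1 = - v f.
Proof.
move=> f0; apply/eqP; rewrite -addr_eq0 -placeM ?invr_eq0 // mulVf //.
by rewrite place1.
Qed.

Lemma place_iota c : c != 0 -> v (iota c) = 0.
Proof. by case: plv => vc _ _ _; apply: vc. Qed.

Lemma placeN f : v (- f) = v f.
Proof.
have [->|f0] := eqVneq f 0; first by rewrite oppr0.
rewrite -mulN1r -(rmorphN1 iota) placeM ?fmorph_eq0 ?oppr_eq0 ?oner_eq0 //.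
by rewrite place_iota ?add0r // oppr_eq0 oner_eq0.
Qed.

Lemma placeX f k : f != 0 -> v (f ^+ k) = v f *+ k.
Proof.
move=> f0; elim: k => [|k IHk]; first by rewrite expr0 place1.
by rewrite exprS placeM ?expf_neq0 // IHk mulrS.
Qed.

(** Zero is allowed at every level, since [v] is arbitrary there; [veq] excludes it. *)
Definition vge n f := f = 0 \/ n <= v f.
Definition veq n f := f != 0 /\ v f = n.

Lemma vge0 n : vge n 0. Proof. by left. Qed.

Lemma vgeW n m f : m <= n -> vge n f -> vge m f.
Proof. by move=> le_mn [->|le_nf]; [left | right; apply: le_trans le_nf]. Qed.

Lemma vgeD n f g : vge n f -> vge n g -> vge n (f + g).
Proof.
have [->|f0] := eqVneq f 0; first by rewrite add0r.
have [->|g0] := eqVneq g 0; first by rewrite addr0.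
have [->|fg0] := eqVneq (f + g) 0; first by left.
case=> [/eqP|fn]; first by rewrite (negPf f0).
case=> [/eqP|gn]; first by rewrite (negPf g0).
have [_ _ /(_ f g f0 g0 fg0)/orP vfg _] := plv.
by right; case: vfg => H; apply: le_trans H.
Qed.

Lemma vgeN n f : vge n f -> vge n (- f).
Proof. by case=> [->|?]; [left; rewrite oppr0 | right; rewrite placeN]. Qed.

Lemma vgeB n f g : vge n f -> vge n g -> vge n (f - g).
Proof. by move=> fn gn; apply: vgeD => //; apply: vgeN. Qed.

Lemma vgeM n m f g : vge n f -> vge m g -> vge (n + m) (f * g).
Proof.
have [->|f0] := eqVneq f 0; first by rewrite mul0r; left.
have [->|g0] := eqVneq g 0; first by rewrite mulr0; left.
case=> [/eqP|fn]; first by rewrite (negPf f0).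
case=> [/eqP|gm]; first by rewrite (negPf g0).
by right; rewrite placeM // lerD.
Qed.

Lemma vge_iota c : vge 0 (iota c).
Proof.
have [->|c0] := eqVneq c 0; first by rewrite rmorph0; left.
by right; rewrite place_iota.
Qed.

Lemma vge1 : vge 0 1. Proof. by right; rewrite place1. Qed.

Lemma vge_nat k : vge 0 (k%:R). Proof. by rewrite -(rmorph_nat iota); apply: vge_iota. Qed.

Lemma vgeX n f k : vge n f -> vge (n *+ k) (f ^+ k).
Proof.
move=> fn; elim: k => [|k IHk]; first by rewrite expr0; apply: vge1.
by rewrite exprS mulrS; apply: vgeM.
Qed.

Lemma vge_sum n (I : Type) (r : seq I) (P : pred I) (E : I -> K) :
  (forall i, P i -> vge n (E i)) -> vge n (\sum_(i <- r | P i) E i).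
Proof. by move=> nE; elim/big_ind: _ => //; [apply: vge0 | apply: vgeD]. Qed.

Lemma veq_vge n f : veq n f -> vge n f.
Proof. by case=> f0 <-; right. Qed.

Lemma veqM n m f g : veq n f -> veq m g -> veq (n + m) (f * g).
Proof. by move=> [f0 <-] [g0 <-]; split; rewrite ?mulf_neq0 // placeM. Qed.

Lemma veqV n f : veq n f -> veq (- n) f^-1.
Proof. by move=> [f0 <-]; split; rewrite ?invr_eq0 // placeV. Qed.

Lemma veqN n f : veq n f -> veq n (- f).
Proof. by move=> [f0 <-]; split; rewrite ?oppr_eq0 // placeN. Qed.

Lemma veq1 : veq 0 1. Proof. by split; rewrite ?oner_neq0 // place1. Qed.

Lemma veqX n f k : veq n f -> veq (n *+ k) (f ^+ k).
Proof. by move=> [f0 <-]; split; rewrite ?expf_neq0 // placeX. Qed.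

Lemma veq_iota c : c != 0 -> veq 0 (iota c).
Proof. by move=> c0; split; rewrite ?fmorph_eq0 // place_iota. Qed.

(** If [f + g] had a value above [n], so would [f = (f + g) - g]. *)
Lemma veqD n f g : veq n f -> vge (n + 1) g -> veq n (f + g).
Proof.
move=> vf vg; have le_f := veq_vge vf; have [f0 fn] := vf.
have Hg : vge n g by apply: vgeW vg; rewrite lerDl.
have nge : ~ vge (n + 1) (f + g).
  move=> /vgeB/(_ vg); rewrite addrK => -[/eqP|]; first by rewrite (negPf f0).
  by rewrite fn gerDl.
have [/eqP|le_fg] := vgeD le_f Hg.
  by move=> /eqP fg0; case: nge; rewrite fg0; left.
have fg0 : f + g != 0 by apply: contra_notN nge => /eqP->; left.
split=> //; apply/eqP; rewrite eq_le le_fg andbT leNgt -lezD1.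
by apply/negP => ?; apply: nge; right.
Qed.

Lemma vge_divl n m f g : vge n (f * g) -> veq m f -> vge (n - m) g.
Proof.
move=> fgn fm; have [f0 _] := fm.
rewrite -(mulKf f0 g) addrC; apply: vgeM => //.
by apply: veq_vge; apply: veqV.
Qed.

Definition valring f := vge 0 f.

Lemma vring_valring : vring valring.
Proof.
split; first split.
- exact: vge1.
- by move=> f g; apply: vgeB.
- by move=> f g fn gn; rewrite /valring -(addr0 0); apply: vgeM.
- move=> f f0; have [le0f|/ltW lef0] := leP 0 (v f); first by left; right.
  by right; right; rewrite placeV // oppr_ge0.
Qed.

Lemma maxid_valring f : maxid valring f <-> vge 1 f.
Proof.
have [->|f0] := eqVneq f 0; first by split; left.
split=> [[/eqP|nf]|[/eqP|le1f]]; try by rewrite (negPf f0).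
  right; rewrite -gtz0_ge1 ltNge; apply/negP => fn; apply: nf; right.
  by rewrite placeV // oppr_ge0.
right=> -[/eqP|]; first by rewrite invr_eq0 (negPf f0).
by rewrite placeV // oppr_ge0 leNgt gtz0_ge1 le1f.
Qed.

End PlaceTheory.

(** * Rational expressions in two generators *)

Section BivariateEvaluation.
Variables (F K : fieldType) (iota : {rmorphism F -> K}).
Implicit Types (x y : K) (p r : {poly {poly F}}).

Lemma ev2D p r x y : ev2 iota (p + r) x y = ev2 iota p x y + ev2 iota r x y.
Proof. by rewrite /ev2 rmorphD !hornerD. Qed.
Lemma ev2N p x y : ev2 iota (- p) x y = - ev2 iota p x y.
Proof. by rewrite /ev2 rmorphN !hornerN. Qed.
Lemma ev2M p r x y : ev2 iota (p * r) x y = ev2 iota p x y * ev2 iota r x y.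
Proof. by rewrite /ev2 rmorphM !hornerM. Qed.
Lemma ev2C f x y : ev2 iota f%:P x y = (map_poly iota f).[x].
Proof. by rewrite /ev2 map_polyC hornerC. Qed.
Lemma ev2X x y : ev2 iota 'X x y = y.
Proof. by rewrite /ev2 map_polyX hornerX hornerC. Qed.
Lemma ev2_1 x y : ev2 iota 1 x y = 1.
Proof. by rewrite /ev2 rmorph1 !hornerC. Qed.
Lemma ev2_0 x y : ev2 iota 0 x y = 0.
Proof. by rewrite /ev2 rmorph0 !horner0. Qed.
Lemma ev2_prod (I : Type) (s : seq I) (P : pred I) (E : I -> {poly {poly F}}) x y :
  ev2 iota (\prod_(i <- s | P i) E i) x y = \prod_(i <- s | P i) ev2 iota (E i) x y.
Proof.
by apply: (big_morph (fun p => ev2 iota p x y)) => [p r|]; [apply: ev2M | apply: ev2_1].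
Qed.

Lemma ev2E p n x y : (size p <= n)%N ->
  ev2 iota p x y = \sum_(j < n) (map_poly iota p`_j).[x] * y ^+ j.
Proof.
move=> le_pn; rewrite /ev2 (@horner_coef_wide _ n (map_poly _ p)) ?(leq_trans (size_poly _ _)) //.
rewrite horner_sum; apply: eq_bigr => j _.
by rewrite coef_map /= hornerM -polyC_exp hornerC.
Qed.

Definition generated x y := forall z : K, exists p r,
  ev2 iota r x y != 0 /\ z = ev2 iota p x y / ev2 iota r x y.

Definition in_frac x y (z : K) := exists p r,
  ev2 iota r x y != 0 /\ z = ev2 iota p x y / ev2 iota r x y.

Lemma in_frac_poly p x y : in_frac x y (ev2 iota p x y).
Proof. by exists p, 1; rewrite ev2_1 divr1 oner_neq0. Qed.
Lemma in_fracD x y z t : in_frac x y z -> in_frac x y t -> in_frac x y (z + t).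
Proof.
move=> [p [r [r0 ->]]] [p' [r' [r'0 ->]]]; exists (p * r' + p' * r), (r * r').
by rewrite ev2D !ev2M mulf_neq0 // addf_div.
Qed.
Lemma in_fracM x y z t : in_frac x y z -> in_frac x y t -> in_frac x y (z * t).
Proof.
move=> [p [r [r0 ->]]] [p' [r' [r'0 ->]]]; exists (p * p'), (r * r').
by rewrite !ev2M mulf_neq0 // mulf_div.
Qed.
Lemma in_fracV x y z : in_frac x y z -> in_frac x y z^-1.
Proof.
move=> [p [r [r0 ->]]]; have [->|p0] := eqVneq (ev2 iota p x y) 0.
  by rewrite mul0r invr0 -(ev2_0 x y); apply: in_frac_poly.
by exists r, p; rewrite invf_div.
Qed.
Lemma in_frac_iota x y c : in_frac x y (iota c).
Proof. by rewrite -(hornerC (iota c) x) -map_polyC -(ev2C _ _ y); apply: in_frac_poly. Qed.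
Lemma in_frac_x x y : in_frac x y x.
Proof. by rewrite -[X in in_frac _ _ X](hornerX x) -(map_polyX iota) -(ev2C _ _ y); apply: in_frac_poly. Qed.
Lemma in_frac_y x y : in_frac x y y.
Proof. by rewrite -[X in in_frac _ _ X](ev2X x y); apply: in_frac_poly. Qed.
Lemma in_fracX x y z n : in_frac x y z -> in_frac x y (z ^+ n).
Proof.
move=> Hz; elim: n => [|n IHn]; last by rewrite exprS; apply: in_fracM.
by rewrite expr0 -(ev2_1 x y); apply: in_frac_poly.
Qed.
Lemma in_frac_sum x y n (E : 'I_n -> K) :
  (forall i, in_frac x y (E i)) -> in_frac x y (\sum_(i < n) E i).
Proof.
move=> HE; elim/big_ind: _ => //; last exact: in_fracD.
by rewrite -(ev2_0 x y); apply: in_frac_poly.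
Qed.

Lemma generated_change x y x' y' : generated x y ->
  in_frac x' y' x -> in_frac x' y' y -> generated x' y'.
Proof.
move=> gen Hx Hy.
have Hp p : in_frac x' y' (ev2 iota p x y).
  rewrite (ev2E _ _ (leqnn _)); apply: in_frac_sum => j; apply: in_fracM; last exact: in_fracX.
  rewrite horner_coef; apply: in_frac_sum => i; apply: in_fracM; last exact: in_fracX.
  by rewrite coef_map; apply: in_frac_iota.
by move=> z; have [p [r [_ ->]]] := gen z; apply: in_fracM => //; apply: in_fracV.
Qed.

End BivariateEvaluation.

(* Fraction-free Gaussian elimination. *)
Lemma exists_left_kernel (R : idomainType) (m : nat) (g : 'I_m.+1 -> 'I_m -> R) :
  exists f : 'I_m.+1 -> R, (exists i, f i != 0) /\ forall j, \sum_i f i * g i j = 0.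
Proof.
elim: m g => [|m IHm] g.
  by exists (fun _ => 1); split; [exists ord0; apply: oner_neq0 | case].
have [[i0 ci0]|no] := pselect (exists i0, g i0 ord_max != 0); last first.
  have [f' [[k0 fk0] Hf']] := IHm (fun i j => g (lift ord0 i) (lift ord_max j)).
  exists (fun i => if unlift ord0 i is Some k then f' k else 0); split.
    by exists (lift ord0 k0); rewrite liftK.
  move=> j; rewrite (bigD1_ord ord0) //= unlift_none mul0r add0r.
  under eq_bigr do rewrite liftK.
  case: (unliftP ord_max j) => [k ->|->]; first exact: Hf'.
  rewrite big1 // => i _; have [->|gi] := eqVneq (g (lift ord0 i) ord_max) 0.
    by rewrite mulr0.
  by case: no; exists (lift ord0 i).
pose h i j := g i0 ord_max * g (lift i0 i) (lift ord_max j)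
   - g (lift i0 i) ord_max * g i0 (lift ord_max j).
have [f' [[k0 fk0] Hf']] := IHm h.
exists (fun i => if unlift i0 i is Some k then g i0 ord_max * f' k
   else - \sum_k f' k * g (lift i0 k) ord_max); split.
  by exists (lift i0 k0); rewrite liftK mulf_neq0.
move=> j; rewrite (bigD1_ord i0) //= unlift_none.
under [X in _ + X]eq_bigr do rewrite liftK.
case: (unliftP ord_max j) => [k ->|->].
  apply: etrans (Hf' k); rewrite mulNr mulr_suml -sumrN -big_split /=.
  by apply: eq_bigr => i _; rewrite /h; ring.
rewrite mulNr mulr_suml -sumrN -big_split /= big1 // => i _; ring.
Qed.

(** * Finiteness of superelliptic extensions [y ^ n = c(x)] *)

Section Superelliptic.
Variables (F K : fieldType) (iota : {rmorphism F -> K}) (x y : K) (n : nat) (c : {poly F}).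
Notation evx f := (map_poly iota f).[x].
Hypothesis gen : generated iota x y.
Hypothesis n_gt0 : (0 < n)%N.
Hypothesis yn : y ^+ n = evx c.

Lemma ev2_reduce p : exists r s : {poly {poly F}},
  (size r <= n)%N /\ p = s * ('X^n - c%:P) + r.
Proof.
have mon : 'X^n - c%:P \is monic by apply: monicXnsubC.
exists (Pdiv.Ring.rmodp p ('X^n - c%:P)), (Pdiv.Ring.rdivp p ('X^n - c%:P)); split.
  by rewrite -ltnS -(size_XnsubC c n_gt0) Pdiv.Ring.ltn_rmodp monic_neq0.
exact: Pdiv.RingMonic.rdivp_eq.
Qed.

Lemma ev2_modulus z : z ^+ n = evx c -> ev2 iota ('X^n - c%:P) x z = 0.
Proof.
move=> zn; rewrite ev2D ev2N ev2C.
have -> : ev2 iota 'X^n x z = z ^+ n.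
  by rewrite /ev2 map_polyXn hornerXn -polyC_exp hornerC.
by rewrite zn subrr.
Qed.

(** Over a common denominator and modulo [Y ^ n - c], the elements become [n + 1] coefficient
    vectors of length [n] over the polynomials in [x], so they are dependent. *)
Lemma generated_dep (u : 'I_n.+1 -> K) : exists f : 'I_n.+1 -> {poly F},
  (exists i, f i != 0) /\ \sum_i evx (f i) * u i = 0.
Proof.
have [p Hp] := choice (fun i => gen (u i)).
have [r Hr] := choice Hp.
pose P i := p i * \prod_(j | j != i) r j.
pose R := ev2 iota (\prod_j r j) x y.
have R0 : R != 0 by rewrite /R ev2_prod; apply/prodf_neq0 => j _; have [] := Hr j.
have uE i : u i * R = ev2 iota (P i) x y.
  rewrite /R (bigD1 i) //= !ev2M mulrA; congr (_ * _).
  by have [r0 Eu] := Hr i; rewrite [u i]Eu divfK.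
have [red Hred] := choice (fun i => ev2_reduce (P i)).
have PE i : ev2 iota (P i) x y = \sum_(j < n) evx (red i)`_j * y ^+ j.
  have [s [sz ->]] := Hred i; rewrite ev2D ev2M ev2_modulus // mulr0 add0r.
  exact: ev2E.
have [f [f0 Hf]] := exists_left_kernel (fun i (j : 'I_n) => (red i)`_j).
exists f; split=> //; apply: (mulIf R0); rewrite mul0r mulr_suml.
under eq_bigr do rewrite -mulrA uE PE mulr_sumr.
rewrite exchange_big big1 //= => j _.
under eq_bigr do rewrite mulrA -hornerM -rmorphM.
by rewrite -mulr_suml -horner_sum -rmorph_sum Hf rmorph0 horner0 mul0r.
Qed.

End Superelliptic.

(** * Kummer automorphisms and traces *)

(** At a pole of [x] the leading term has strictly the least value. *)
Lemma place_pole_poly (F K : fieldType) (iota : {rmorphism F -> K}) (w : K -> int) (x : K)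
    (f : {poly F}) : is_place iota w -> x != 0 -> w x < 0 -> f != 0 ->
  veq w (w x *+ (size f).-1) (map_poly iota f).[x].
Proof.
move=> plw x0 wx f0; have szf : size f = (size f).-1.+1.
  by rewrite prednK // size_poly_gt0.
rewrite horner_coef size_map_poly szf big_ord_recr /= addrC.
have vx : veq w (w x) x by split.
apply: (veqD plw).
  rewrite -[X in veq _ X _]add0r; apply: (veqM plw); last exact: (veqX plw).
  by rewrite coef_map; apply: (veq_iota plw); rewrite -lead_coefE lead_coef_eq0.
apply: (vge_sum plw) => i _; rewrite -[X in vge _ X _]add0r.
apply: (vgeM plw); first by rewrite coef_map; apply: (vge_iota plw).
apply: vgeW (veq_vge (veqX plw i vx)).
have : (i.+1%:R <= (size f).-1%:R :> int) by rewrite ler_nat ltn_ord.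
move=> /(ler_wnM2l (ltW wx)); rewrite -[i.+1%:R](natr1 i) mulrDr mulr1 !mulr_natr.
by move: (w x *+ _) (w x *+ _) wx => A B; lia.
Qed.

Lemma place_zero_poly (F K : fieldType) (iota : {rmorphism F -> K}) (w : K -> int) (x : K)
    (f : {poly F}) : is_place iota w -> (map_poly iota f).[x] != 0 ->
  0 < w (map_poly iota f).[x] -> vge w 0 x.
Proof.
move=> plw f0 wf; have [->|x0] := eqVneq x 0; first by left.
have [le0|lt0] := leP 0 (w x); first by right.
have fn0 : f != 0 by apply: contra_neq f0 => ->; rewrite rmorph0 horner0.
have [_ E] := place_pole_poly plw x0 lt0 fn0.
by move: wf; rewrite E ltNge mulrn_wle0 // ltW.
Qed.

Lemma vunit_valring (F K : fieldType) (iota : {rmorphism F -> K}) (w : K -> int) (u : K) :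
  is_place iota w -> vunit (valring w) u -> veq w 0 u.
Proof.
move=> plw [u0 Su Su']; case: Su => [/eqP|le1]; first by rewrite (negPf u0).
case: Su' => [/eqP|le2]; first by rewrite invr_eq0 (negPf u0).
split=> //; apply/eqP; rewrite eq_le le1 andbT.
by move: le2; rewrite (placeV plw) // oppr_ge0.
Qed.

Lemma place_irreducible_poly (F K : fieldType) (iota : {rmorphism F -> K}) (w : K -> int)
    (x : K) (pi f : {poly F}) :
  is_place iota w -> irreducible_poly pi -> (map_poly iota pi).[x] != 0 ->
  0 < w (map_poly iota pi).[x] -> ~~ (pi %| f) -> veq w 0 (map_poly iota f).[x].
Proof.
move=> plw irr pi0 wpi ndvd; apply: (vunit_valring plw).
apply: (vunit_coprime (vring_valring plw) _ _ irr _ ndvd).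
- by move=> c; apply: (vge_iota plw).
- exact: (place_zero_poly plw pi0 wpi).
- by apply/(maxid_valring plw); right; rewrite -gtz0_ge1.
Qed.

Section Kummer.
Variables (F K : fieldType) (iota : {rmorphism F -> K}) (x y : K) (n : nat) (c : {poly F}).
Notation evx f := (map_poly iota f).[x].
Hypothesis tr : forall f : {poly F}, f != 0 -> evx f != 0.
Hypothesis gen : generated iota x y.
Hypothesis n_gt0 : (0 < n)%N.
Hypothesis yn : y ^+ n = evx c.
Variables (pi g : {poly F}).
Hypothesis irr_pi : irreducible_poly pi.
Hypothesis c_pi : c = pi * g.
Hypothesis pi_g : ~~ (pi %| g).

(* The powers of [y] have distinct values, modulo the value of [pi], at a place over [pi]:
   this is where the place is totally ramified. *)
Lemma powers_free (f : 'I_n -> {poly F}) : \sum_j evx (f j) * y ^+ j = 0 -> forall j, f j = 0.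
Proof.
move=> sum0 j0; apply/eqP/negPn/negP => fj0.
have [w [plw wpi]] := exists_place tr (generated_dep gen n_gt0 yn) irr_pi.
have pin0 := irredp_neq0 irr_pi; have pi0 := tr pin0.
have g0 : g != 0 by apply: contraNneq pi_g => ->; apply: dvdp0.
have c0 : c != 0 by rewrite c_pi mulf_neq0 // irredp_neq0.
have y0 : y != 0.
  by apply: contra_neq (tr c0) => y0; rewrite -yn y0 expr0n -leqn0 leqNgt n_gt0.
have wy : w (evx pi) = w y *+ n.
  rewrite -(placeX plw) // yn c_pi rmorphM hornerM (placeM plw) ?tr //.
  by have [_ ->] := place_irreducible_poly plw irr_pi pi0 wpi pi_g; rewrite addr0.
have wy0 : 0 < w y by move: wpi; rewrite wy pmulrn_lgt0.
have fy0 : evx (f j0) * y ^+ j0 != 0 by rewrite mulf_neq0 ?tr ?expf_neq0.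
have [i [j [ij fi fj]]] := sum_eq0_vunit (vring_valring plw) sum0 fy0.
case/(vunit_valring plw) => [_].
have {}fi : f i != 0 by apply: contra_neq fi => ->; rewrite rmorph0 horner0 mul0r.
have {}fj : f j != 0 by apply: contra_neq fj => ->; rewrite rmorph0 horner0 mul0r.
have val h : h != 0 -> exists k : nat, w (evx h) = w y *+ (k * n).
  move=> h0.
  have Sc b : valring w (iota b) by apply: (vge_iota plw).
  have Sx : valring w x := place_zero_poly plw pi0 wpi.
  have Mpi : maxid (valring w) (evx pi) by apply/(maxid_valring plw); right; rewrite -gtz0_ge1.
  have [k [u [/(vunit_valring plw)[u0 u1] ->]]] :=
    evx_pi_unit (vring_valring plw) Sc Sx irr_pi Mpi h0.
  exists k; rewrite (placeM plw) ?expf_neq0 // u1 addr0 (placeX plw) // wy.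
  by rewrite -mulrnA mulnC.
have [ki Ei] := val _ fi; have [kj Ej] := val _ fj.
rewrite !(placeM plw, placeV plw, placeX plw) ?(invr_eq0, mulf_neq0, expf_neq0, tr) //.
rewrite Ei Ej -!mulrnDr => /eqP; rewrite subr_eq0 => /eqP/(mulrIn (lt0r_neq0 wy0)) E.
case/eqP: ij; apply: val_inj; rewrite /= -(modn_small (ltn_ord i)) -(modn_small (ltn_ord j)).
by rewrite -(modnMDl ki) -(modnMDl kj j) E.
Qed.

(** One remainder modulo [Y ^ n - c] serves all conjugates of [y] at once. *)
Lemma ev2_mod p : exists r : {poly {poly F}}, (size r <= n)%N /\
  forall z, z ^+ n = evx c -> ev2 iota p x z = \sum_(j < n) evx r`_j * z ^+ j.
Proof.
have [r [s [sz ->]]] := ev2_reduce c n_gt0 p; exists r; split=> // z zn.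
by rewrite ev2D ev2M ev2_modulus // mulr0 add0r; apply: ev2E.
Qed.

Variable zeta : F.
Hypothesis zeta_n : zeta ^+ n = 1.

Let zeta_neq0 : zeta != 0.
Proof.
by apply: contra_eq_neq zeta_n => ->; rewrite expr0n -leqn0 leqNgt n_gt0 eq_sym oner_neq0.
Qed.

Let twist_n : (iota zeta * y) ^+ n = evx c.
Proof. by rewrite exprMn -rmorphXn zeta_n rmorph1 mul1r. Qed.

(** By [powers_free] vanishing means that the remainder is zero, and [y -> zeta y] only scales its
    coefficients by powers of [zeta]. *)
Lemma ev2_twist_eq0 p : ev2 iota p x (iota zeta * y) = 0 <-> ev2 iota p x y = 0.
Proof.
have [r [sz Hr]] := ev2_mod p; rewrite !Hr //.
split=> H0; last first.
  by rewrite big1 // => j _; rewrite (powers_free H0) rmorph0 horner0 mul0r.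
rewrite big1 // => j _.
have H j' : zeta ^+ (j' : 'I_n) *: r`_j' = 0.
  apply: (powers_free (f := fun j => zeta ^+ j *: r`_j)); rewrite -[RHS]H0.
  apply: eq_bigr => i _; rewrite map_polyZ hornerZ exprMn rmorphXn; ring.
have /eqP := H j; rewrite scaler_eq0 expf_eq0 (negPf zeta_neq0) andbF => /eqP->.
by rewrite rmorph0 horner0 mul0r.
Qed.

(** The automorphism [y -> zeta y] over the rational functions in [x], specified on fractions; its
    ring laws are derived from this below. *)
Definition twist_spec (s : K -> K) := forall p r, ev2 iota r x y != 0 ->
  s (ev2 iota p x y / ev2 iota r x y) =
  ev2 iota p x (iota zeta * y) / ev2 iota r x (iota zeta * y).

Lemma exists_twist : exists s, twist_spec s.
Proof.
have ex z : exists t, exists p r, [/\ ev2 iota r x y != 0, z = ev2 iota p x y / ev2 iota r x y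
   & t = ev2 iota p x (iota zeta * y) / ev2 iota r x (iota zeta * y)].
  by have [p [r [r0 zE]]] := gen z; do 3?eexists; split; eauto.
have [s Hs] := choice ex; exists s => p r r0.
have [p' [r' [r'0 /eqP]]] := Hs (ev2 iota p x y / ev2 iota r x y).
rewrite eqr_div // => /eqP E ->.
have nz q : ev2 iota q x y != 0 -> ev2 iota q x (iota zeta * y) != 0.
  by apply: contra_neq => /ev2_twist_eq0.
apply/eqP; rewrite eqr_div ?nz // -subr_eq0 -!ev2M -ev2N -ev2D; apply/eqP/ev2_twist_eq0.
by rewrite ev2D ev2N !ev2M E subrr.
Qed.

Section TwistTheory.
Variable s : K -> K.
Hypothesis s_twist : twist_spec s.

Lemma twist_poly p : s (ev2 iota p x y) = ev2 iota p x (iota zeta * y).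
Proof.
have := s_twist p (r := 1); rewrite !ev2_1 !divr1; apply; exact: oner_neq0.
Qed.

Let nz q : ev2 iota q x y != 0 -> ev2 iota q x (iota zeta * y) != 0.
Proof. by apply: contra_neq => /ev2_twist_eq0. Qed.

Lemma twistD u v : s (u + v) = s u + s v.
Proof.
have [p [r [r0 ->]]] := gen u; have [p' [r' [r'0 ->]]] := gen v.
rewrite addf_div // -!ev2M -ev2D !s_twist //; last by rewrite ev2M mulf_neq0.
by rewrite addf_div ?nz // ev2D !ev2M.
Qed.

Lemma twistM u v : s (u * v) = s u * s v.
Proof.
have [p [r [r0 ->]]] := gen u; have [p' [r' [r'0 ->]]] := gen v.
rewrite mulf_div // -!ev2M !s_twist //; last by rewrite ev2M mulf_neq0.
by rewrite mulf_div !ev2M.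
Qed.

Lemma twist_evx f : s (evx f) = evx f.
Proof. by rewrite -[X in s X](ev2C iota f x y) twist_poly ev2C. Qed.

Lemma twist_iota b : s (iota b) = iota b.
Proof. by have := twist_evx b%:P; rewrite map_polyC hornerC. Qed.

Lemma twist_x : s x = x.
Proof. by have := twist_evx 'X; rewrite map_polyX hornerX. Qed.

Lemma twist_y : s y = iota zeta * y.
Proof. by rewrite -[X in s X](ev2X iota x y) twist_poly ev2X. Qed.

Lemma twist1 : s 1 = 1.
Proof. by rewrite -(rmorph1 iota) twist_iota. Qed.

Lemma twist0 : s 0 = 0.
Proof. by rewrite -(rmorph0 iota) twist_iota. Qed.

Lemma twistB u v : s (u - v) = s u - s v.
Proof. by rewrite -mulN1r -(rmorphN1 iota) twistD twistM twist_iota rmorphN1 mulN1r. Qed.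

Lemma twist_neq0 u : u != 0 -> s u != 0.
Proof.
move=> u0; apply: contra_neq (oner_neq0 K) => su0.
by rewrite -twist1 -(mulfV u0) twistM su0 mul0r.
Qed.

(** Preimages come from [Y -> zeta^-1 Y]. Surjectivity keeps the valuation [w \o s] normalised. *)
Lemma twist_surj z : exists u, s u = z.
Proof.
have [p [r [r0 ->]]] := gen z.
pose h q := q \Po ((zeta^-1)%:P *: 'X).
have hE q : s (ev2 iota (h q) x y) = ev2 iota q x y.
  rewrite twist_poly (ev2E iota x y (leqnn (size q))) /h comp_polyE.
  rewrite (big_morph (fun q => ev2 iota q x (iota zeta * y))
             (fun p r => ev2D iota p r _ _) (ev2_0 iota _ _)).
  apply: eq_bigr => j _; rewrite -mul_polyC ev2M ev2C; congr (_ * _).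
  rewrite exprZn -mul_polyC ev2M ev2C /= -polyC_exp map_polyC hornerC.
  rewrite (_ : ev2 iota 'X^j x (iota zeta * y) = (iota zeta * y) ^+ j); last first.
    by rewrite /ev2 map_polyXn hornerXn -polyC_exp hornerC.
  have E : (iota zeta)^-1 ^+ j = iota (zeta^-1 ^+ j) by rewrite -fmorphV -rmorphXn.
  transitivity ((iota zeta)^-1 ^+ j * (iota zeta * y) ^+ j).
    by congr (_ * _); symmetry; exact: E.
  by rewrite -exprMn mulKf // fmorph_eq0.
have hr0 : ev2 iota (h r) x y != 0.
  by apply: contra_neq r0 => h0; rewrite -hE h0 twist0.
exists (ev2 iota (h p) x y / ev2 iota (h r) x y); rewrite s_twist // -!twist_poly.
by rewrite !hE.
Qed.

Lemma twist_place w : is_place iota w -> is_place iota (w \o s).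
Proof.
move=> plw; split=> [b b0|f h f0 h0|f h f0 h0 fh0|] /=.
- by rewrite twist_iota (place_iota plw).
- by rewrite twistM (placeM plw) // twist_neq0.
- have [_ _ H _] := plw; rewrite twistD; apply: H; rewrite -?twistD; exact: twist_neq0.
- have [_ _ _ [t [t0 wt]]] := plw; have [u Eu] := twist_surj t; exists u.
  by rewrite Eu; split=> //; apply: contra_neq t0 => u0; rewrite -Eu u0 twist0.
Qed.

End TwistTheory.

(** The denominator satisfies an algebraic equation over the polynomials in [x]. Once the equation
    is divided by a power of the denominator so that its constant coefficient is nonzero, this
    coefficient is a multiple of the denominator. *)
Lemma clear_denominator z : exists p f, f != 0 /\ z = ev2 iota p x y / evx f.
Proof.
have [p [r [r0 ->]]] := gen z.
suff [h [f [f0 E]]] : exists h f, f != 0 /\ ev2 iota r x y * ev2 iota h x y = evx f.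
  have h0 : ev2 iota h x y != 0.
    by apply: contra_neq (tr f0) => h0; rewrite -E h0 mulr0.
  exists (p * h), f; split=> //; rewrite ev2M -E invfM mulrACA divff ?mulr1 //.
have lowest k (f : nat -> {poly F}) : (exists i, (i < k)%N && (f i != 0)) ->
    \sum_(i < k) evx (f i) * ev2 iota r x y ^+ i = 0 ->
    exists h g, g != 0 /\ ev2 iota r x y * ev2 iota h x y = evx g.
  elim: k f => [|k IHk] f [i /andP[lt_ik fi]] //.
  rewrite big_ord_recl expr0 mulr1; have [f0|f0] := eqVneq (f 0%N) 0.
    rewrite f0 rmorph0 horner0 add0r => sum0; apply: (IHk (fun i => f i.+1)).
      case: i lt_ik fi => [|i] lt_ik fi; first by rewrite f0 eqxx in fi.
      by exists i; rewrite -ltnS lt_ik.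
    apply: (mulfI r0); rewrite mulr0 -[RHS]sum0 mulr_sumr; apply: eq_bigr => j _.
    by rewrite lift0 exprS; ring.
  move/eqP; rewrite addr_eq0 => /eqP E.
  exists (- \sum_(j < k) (f j.+1)%:P * r ^+ j), (f 0%N); split=> //.
  have evX j : ev2 iota (r ^+ j) x y = ev2 iota r x y ^+ j.
    by elim: j => [|j IHj]; rewrite ?expr0 ?ev2_1 // !exprS ev2M IHj.
  rewrite E ev2N mulrN; congr (- _).
  rewrite (big_morph (fun q => ev2 iota q x y) (fun p r => ev2D iota p r _ _) (ev2_0 iota _ _)).
  rewrite mulr_sumr; apply: eq_bigr => j _.
  by rewrite ev2M ev2C evX lift0 exprS; ring.
have [f [[i0 fi0] sum0]] := generated_dep gen n_gt0 yn (fun i => ev2 iota r x y ^+ i).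
apply: (lowest n.+1 (fun i => f (inord i))).
  by exists i0; rewrite ltn_ord inord_val.
by rewrite -[RHS]sum0; apply: eq_bigr => i _; rewrite inord_val.
Qed.

End Kummer.

Section Trace.
Variables (F K : fieldType) (iota : {rmorphism F -> K}) (x y : K) (n : nat) (c : {poly F}).
Notation evx f := (map_poly iota f).[x].
Hypothesis n_gt0 : (0 < n)%N.
Hypothesis yn : y ^+ n = evx c.
Variable zeta : F.
Hypothesis prim_zeta : n.-primitive_root zeta.

Lemma sum_prim_root j : (0 < j < n)%N -> \sum_(i < n) (zeta ^+ j) ^+ i = 0.
Proof.
move=> /andP[j0 lt_jn]; have zj : zeta ^+ j - 1 != 0.
  rewrite subr_eq0 -(prim_order_dvd prim_zeta); apply: contraL lt_jn => /dvdn_leq le.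
  by rewrite -leqNgt le.
apply: (mulfI zj); rewrite mulr0 -subrX1 -exprM mulnC exprM (prim_expr_order prim_zeta).
by rewrite expr1n subrr.
Qed.

(** The sum over the conjugates kills [y ^ j] for [0 < j < n], so only the constant coefficient of
    the remainder survives, multiplied by [n]. *)
Lemma trace_poly p : exists f, \sum_(i < n) ev2 iota p x (iota (zeta ^+ i) * y) = evx f.
Proof.
have [r [sz Hr]] := ev2_mod iota x c n_gt0 p.
exists (r`_0 *+ n); rewrite rmorphMn hornerMn.
transitivity (\sum_(i < n) \sum_(j < n) evx r`_j * y ^+ j * iota ((zeta ^+ j) ^+ i)).
  apply: eq_bigr => i _; rewrite (Hr _ _); last first.
    by rewrite exprMn -rmorphXn exprAC (prim_expr_order prim_zeta) expr1n rmorph1 mul1r.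
  by apply: eq_bigr => j _; rewrite exprMn -rmorphXn exprAC; ring.
rewrite exchange_big /=; case: n n_gt0 prim_zeta sum_prim_root => // k _ _ Hs.
rewrite big_ord_recl /= [X in _ + X]big1 => [|j _]; last first.
  by rewrite -mulr_sumr -rmorph_sum Hs ?rmorph0 ?mulr0 //= ltnS ltn_ord.
rewrite addr0 -mulr_sumr -rmorph_sum expr0 mulr1.
under eq_bigr do rewrite expr1n.
by rewrite sumr_const card_ord rmorphMn rmorph1 mulr_natr.
Qed.

End Trace.

(** * The tangent plane of the cubic surface *)

Section CubicSurface.
Variables (K : fieldType) (W : K) (A B C D : K).
Hypothesis HW : W ^+ 2 + W + 1 = 0.
Hypothesis surf : A * B * C = D ^+ 3.

(** With [a + b + c], the forms [lin1] and [lin2] make up the discrete Fourier transform of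
    [(a, b, c)]; both vanish where [a = b = c]. *)
Definition lin1 (a b c : K) := a + W ^+ 2 * b + W * c.
Definition lin2 (a b c : K) := a + W * b + W ^+ 2 * c.
Definition tangent (a b c d : K) : K := a + b + c - 3 * d.
(** The quotient of [(a + b + c) ^ 3 - 27 d ^ 3] by [tangent a b c d]. *)
Definition cofactor (a b c d : K) : K :=
  27 * d ^+ 2 + 9 * d * tangent a b c d + tangent a b c d ^+ 2.

Local Notation R1 := (lin1 A B C).
Local Notation R2 := (lin2 A B C).
Local Notation S3 := (A + B + C).
Local Notation hk := (tangent A B C D * cofactor A B C D).

(** Turns an identity modulo [W ^ 2 + W + 1] into a plain ring identity; the long expressions
    supplied for [c] below are the quotients of the division by this polynomial. *)
Lemma modW (u v c : K) : u = v + (W ^+ 2 + W + 1) * c -> u = v.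
Proof. by rewrite HW mul0r addr0. Qed.

Lemma linA : 3 * A = S3 + R1 + R2.
Proof. by symmetry; apply: (modW (c := B + C)); rewrite /lin1 /lin2; ring. Qed.

Lemma linB : 3 * B = S3 + W * R1 + W ^+ 2 * R2.
Proof.
symmetry; apply: (modW (c := C - 2 * B + A - W * C + 2 * W * B + W ^+ 2 * C)).
by rewrite /lin1 /lin2; ring.
Qed.

Lemma linC : 3 * C = S3 + W ^+ 2 * R1 + W * R2.
Proof.
symmetry; apply: (modW (c := - 2 * C + B + A + 2 * W * C - W * B + W ^+ 2 * B)).
by rewrite /lin1 /lin2; ring.
Qed.

(** The product of [3 A], [3 B], [3 C] is [S3 ^ 3 + R1 ^ 3 + R2 ^ 3 - 3 S3 R1 R2], and the surface
    replaces [A B C] by [D ^ 3]. On the tangent plane this is a cubic with node [R1 = R2 = 0]. *)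
Lemma nodal_cubic : R1 ^+ 3 + R2 ^+ 3 = 3 * S3 * R1 * R2 - hk.
Proof.
transitivity (3 * S3 * R1 * R2 + 27 * (A * B * C) - S3 ^+ 3); last first.
  by rewrite surf /cofactor /tangent; ring.
apply: (modW (c := C ^+ 3 + 3 * B * C ^+ 2 + 3 * B ^+ 2 * C + B ^+ 3 + 3 * A * C ^+ 2 - 21 * A * B * C + 3 *
  A * B ^+ 2 - W * C ^+ 3 - 3 * W * B * C ^+ 2 - 3 * W * B ^+ 2 * C - W * B ^+ 3 - 6 * W *
  A * C ^+ 2 + 15 * W * A * B * C - 6 * W * A * B ^+ 2 - 3 * W ^+ 2 * B * C ^+ 2 - 3 * W
  ^+ 2 * B ^+ 2 * C + 3 * W ^+ 2 * A * C ^+ 2 - 3 * W ^+ 2 * A * B * C + 3 * W ^+ 2 * A *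
  B ^+ 2 - W ^+ 3 * C ^+ 3 + 3 * W ^+ 3 * B * C ^+ 2 + 3 * W ^+ 3 * B ^+ 2 * C - W ^+ 3 *
  B ^+ 3 + W ^+ 4 * C ^+ 3 + W ^+ 4 * B ^+ 3)).
by rewrite /lin1 /lin2; ring.
Qed.

(** On the nodal cubic [A] is, up to the factor [9 R1 R2], the cube of a linear form. [cubeB] and
    [cubeC] are the versions twisted by [W]. *)
Lemma cubeA : (R1 + R2) ^+ 3 = 9 * R1 * R2 * A - hk.
Proof.
transitivity (R1 ^+ 3 + R2 ^+ 3 + 3 * R1 * R2 * (R1 + R2)); first by ring.
by rewrite nodal_cubic (_ : 9 * R1 * R2 * A = 3 * R1 * R2 * (3 * A)); [rewrite linA; ring | ring].
Qed.

Lemma cubeB : (W * R1 + W ^+ 2 * R2) ^+ 3 = 9 * R1 * R2 * B - hk.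
Proof.
transitivity (R1 ^+ 3 + R2 ^+ 3 + 3 * R1 * R2 * (W * R1 + W ^+ 2 * R2)).
  move: R1 R2 => a b.
  apply: (modW (c := - b ^+ 3 - a ^+ 3 + W * b ^+ 3 - 3 * W * a ^+ 2 * b + W * a ^+ 3 - 3 * W ^+ 2 * a * b ^+ 2
  + 3 * W ^+ 2 * a ^+ 2 * b - W ^+ 3 * b ^+ 3 + 3 * W ^+ 3 * a * b ^+ 2 + W ^+ 4 * b ^+ 3)).
  by ring.
by rewrite nodal_cubic (_ : 9 * R1 * R2 * B = 3 * R1 * R2 * (3 * B)); [rewrite linB; ring | ring].
Qed.

Lemma cubeC : (W ^+ 2 * R1 + W * R2) ^+ 3 = 9 * R1 * R2 * C - hk.
Proof.
transitivity (R1 ^+ 3 + R2 ^+ 3 + 3 * R1 * R2 * (W ^+ 2 * R1 + W * R2)).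
  move: R1 R2 => a b.
  apply: (modW (c := - b ^+ 3 - a ^+ 3 + W * b ^+ 3 - 3 * W * a * b ^+ 2 + W * a ^+ 3 + 3 * W ^+ 2 * a * b ^+ 2
  - 3 * W ^+ 2 * a ^+ 2 * b + 3 * W ^+ 3 * a ^+ 2 * b - W ^+ 3 * a ^+ 3 + W ^+ 4 * a ^+ 3)).
  by ring.
by rewrite nodal_cubic (_ : 9 * R1 * R2 * C = 3 * R1 * R2 * (3 * C)); [rewrite linC; ring | ring].
Qed.

Variables (q m : nat).
Hypothesis Hm : (3 * m = q.+1)%N.
Hypothesis frob : forall u v : K, (u + v) ^+ q = u ^+ q + v ^+ q.
Hypothesis Wq : W ^+ q = W ^+ 2.
Hypothesis Hm1 : (3 * m%:R = 1 :> K).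

Let WW : W * W ^+ 2 = 1.
Proof. by apply: (modW (c := W - 1)); ring. Qed.

Let Wq2 : (W ^+ 2) ^+ q = W.
Proof.
by rewrite exprAC Wq -[RHS]mul1r -WW; ring.
Qed.

Let frobB (a b : K) : (W * a + W ^+ 2 * b) ^+ q = W ^+ 2 * a ^+ q + W * b ^+ q.
Proof. by rewrite frob [(W * a) ^+ q]exprMn [(W ^+ 2 * b) ^+ q]exprMn Wq Wq2. Qed.

Let frobC (a b : K) : (W ^+ 2 * a + W * b) ^+ q = W * a ^+ q + W ^+ 2 * b ^+ q.
Proof. by rewrite addrC frobB addrC. Qed.

(** The left-hand side is the Fermat form with [A], [B], [C] replaced by cubes, as [3 m = q + 1].
    Additivity of the [q]-th power expands it in four monomials, of which the weights leave one. *)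
Lemma weighted_sum (a b : K) :
  W * (a + b) ^+ q.+1 + W ^+ 2 * (W * a + W ^+ 2 * b) ^+ q.+1 + (W ^+ 2 * a + W * b) ^+ q.+1
  = 3 * W * a * b ^+ q.
Proof.
rewrite 3!(exprS _ q) frobB frobC frob; move: (a ^+ q) (b ^+ q) => c d.
apply: (modW (c := W * b * d + W * b * c - 2 * W * a * d + W * a * c - W ^+ 2 * b * d + 2 * W ^+ 2 * a * d -
  W ^+ 2 * a * c + W ^+ 3 * b * d - W ^+ 3 * b * c + W ^+ 3 * a * c + W ^+ 4 * b * c)).
by ring.
Qed.

Lemma nat3_frob k : (k%:R : K) ^+ q = k%:R.
Proof.
have q0 : (0 < q)%N by lia.
elim: k => [|k IHk]; first by rewrite expr0n eqn0Ngt q0.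
by rewrite -natr1 frob IHk expr1n.
Qed.

Section Residue.
Variable S : K -> Prop.
Hypothesis vringS : vring S.
Hypotheses (SW : S W) (SA : S A) (SB : S B) (SC : S C) (SD : S D).
Hypothesis fermat : W * A ^+ m + W ^+ 2 * B ^+ m + C ^+ m = 0.
Hypothesis h_maxid : maxid S (tangent A B C D).

Let ringS : ring_set S. Proof. by case: vringS. Qed.

Let Snat k : S k%:R.
Proof.
elim: k => [|k IHk]; first exact: ring_set0.
by rewrite -natr1; apply: ring_setD => //; apply: ring_set1.
Qed.

Let maxid3 u : maxid S (3 * u) -> maxid S u.
Proof.
move=> M3; rewrite -[u]mul1r -Hm1 (_ : 3 * m%:R * u = m%:R * (3 * u)); last by ring.
exact: maxidMr.
Qed.

(* Modulo the maximal ideal, [A, B, C] are, up to a common factor, the cubes of [R1 + R2],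
   [W R1 + W^2 R2], [W^2 R1 + W R2], so that their [m]-th powers are the [q + 1]-st powers of
   these linear forms. *)
Lemma tangent_residue : [/\ maxid S (A - D), maxid S (B - D) & maxid S (C - D)].
Proof.
have SW2 : S (W ^+ 2) by apply: ring_setX.
have SR1 : S R1 by do 2?apply: ring_setD => //; apply: ring_setM.
have SR2 : S R2 by do 2?apply: ring_setD => //; apply: ring_setM.
have Mhk : maxid S hk.
  apply: maxidMl => //; have Sh := maxidW vringS h_maxid.
  by apply: ring_setD => //; [apply: ring_setD => //|]; rewrite ?expr2; do ?apply: ring_setM.
have pow_cong (L E : K) : S E -> L ^+ 3 = 9 * R1 * R2 * E - hk ->
    maxid S (L ^+ q.+1 - (9 * R1 * R2) ^+ m * E ^+ m).
  move=> SE LE; rewrite -Hm exprM LE -exprMn subrXX; apply: maxidMl => //.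
    by rewrite addrC addKr; apply: maxidN.
  have SRE : S (9 * R1 * R2 * E) by do 3?apply: ring_setM.
  apply: ring_set_sum => // i _; apply: ring_setM => //; apply: ring_setX => //.
  by apply: ring_setB => //; apply: maxidW.
have M12 : maxid S (R1 * R2 ^+ q).
  have : maxid S (W * (3 * (R1 * R2 ^+ q))).
    rewrite (_ : W * _ = W * ((R1 + R2) ^+ q.+1 - (9 * R1 * R2) ^+ m * A ^+ m)
      + W ^+ 2 * ((W * R1 + W ^+ 2 * R2) ^+ q.+1 - (9 * R1 * R2) ^+ m * B ^+ m)
      + ((W ^+ 2 * R1 + W * R2) ^+ q.+1 - (9 * R1 * R2) ^+ m * C ^+ m)).
      apply: maxidD => //; last by apply: pow_cong => //; apply: cubeC.
      by apply: maxidD => //; apply: maxidMr => //; apply: pow_cong => //;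
        [apply: cubeA | apply: cubeB].
    transitivity (3 * W * R1 * R2 ^+ q - (9 * R1 * R2) ^+ m * (W * A ^+ m + W ^+ 2 * B ^+ m + C ^+ m)).
      by rewrite fermat; ring.
    by rewrite -weighted_sum; ring.
  move/(maxidMr vringS SW2); rewrite mulrA [W ^+ 2 * W]mulrC WW mul1r; exact: maxid3.
have M12' : maxid S (R1 * R2).
  have [M1|M2q] := maxid_prime vringS SR1 (ring_setX ringS q SR2) M12.
    exact: maxidMl.
  by apply: maxidMr => //; apply: maxid_primeX M2q.
(* With both the product and the sum of cubes in the maximal ideal, only the node [R1 = R2 = 0]
   remains. *)
have M33 : maxid S (R1 ^+ 3 + R2 ^+ 3).
  rewrite nodal_cubic (_ : 3 * S3 * R1 * R2 = 3 * S3 * (R1 * R2)); last by ring.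
  apply: maxidB => //; apply: maxidMr => //.
  by apply: ring_setM => //; do 2?apply: ring_setD => //.
have [M1 M2] : maxid S R1 /\ maxid S R2.
  have [M1|M2] := maxid_prime vringS SR1 SR2 M12'.
    split=> //; apply: (@maxid_primeX K S vringS R2 3) => //.
    rewrite (_ : R2 ^+ 3 = (R1 ^+ 3 + R2 ^+ 3) - R1 ^+ 2 * R1); last by ring.
    by apply: maxidB => //; apply: maxidMr => //; apply: ring_setX.
  split=> //; apply: (@maxid_primeX K S vringS R1 3) => //.
  rewrite (_ : R1 ^+ 3 = (R1 ^+ 3 + R2 ^+ 3) - R2 ^+ 2 * R2); last by ring.
  by apply: maxidB => //; apply: maxidMr => //; apply: ring_setX.
split; apply: maxid3.
- rewrite mulrBr linA (_ : _ - _ = tangent A B C D + R1 + R2); last by rewrite /tangent; ring.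
  by do 2?apply: maxidD => //.
- rewrite mulrBr linB (_ : _ - _ = tangent A B C D + W * R1 + W ^+ 2 * R2).
    by do 2?[apply: maxidD => //]; apply: maxidMr.
  by rewrite /tangent; ring.
- rewrite mulrBr linC (_ : _ - _ = tangent A B C D + W ^+ 2 * R1 + W * R2).
    by do 2?[apply: maxidD => //]; apply: maxidMr.
  by rewrite /tangent; ring.
Qed.

End Residue.

Lemma hermitian_cubic (X Z : K) : X + Z + 1 = 0 -> X ^+ 3 + Z ^+ 3 + 1 = 3 * X * Z.
Proof.
move=> H; have -> : Z = - 1 - X by rewrite -[Z]addr0 -oppr0 -H; ring.
by ring.
Qed.

(** The Fourier transform multiplies the Hermitian form by 3, and [3 ^ (q + 1) = 9]. In the new
    forms [S3] differs from [3 D] by the tangent form, whose order can then be read off. *)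
Lemma hermitian_tangent : A ^+ q.+1 + B ^+ q.+1 + C ^+ q.+1 = 3 * D ^+ q.+1 ->
  S3 ^+ q.+1 + R1 ^+ q.+1 + R2 ^+ q.+1 = (3 * D) ^+ q.+1.
Proof.
move=> H; have three0 : (3 : K) != 0.
  by apply: contra_eq_neq Hm1 => ->; rewrite mul0r eq_sym oner_neq0.
have E3 (u : K) : (3 * u) ^+ q.+1 = 9 * u ^+ q.+1.
  by rewrite exprMn [3 ^+ _]exprS nat3_frob; ring.
apply: (mulfI three0); transitivity ((3 * A) ^+ q.+1 + (3 * B) ^+ q.+1 + (3 * C) ^+ q.+1).
  rewrite linA linB linC; move: S3 R1 R2 => {H} S a b.
  rewrite !(exprS _ q) -!(addrA S) !(frob S) frob frobB frobC; move: (a ^+ q) (b ^+ q) (S ^+ q) => c d s.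
  symmetry; apply: (modW (c := b * s - 2 * b * d + b * c + a * s + a * d - 2 * a * c + S * d + S * c + 2 * W * b * d - W
  * b * c - W * a * d + 2 * W * a * c + W ^+ 2 * b * c + W ^+ 2 * a * d)).
  by ring.
rewrite !E3 -!mulrDr H; ring.
Qed.

End CubicSurface.

(** * The local ring at the point (1, 1) *)

Section LocalRing.
Variables (q m : nat) (F K : fieldType) (iota : {rmorphism F -> K}) (x y : K) (om : F).
Notation evx f := (map_poly iota f).[x].
Notation ev p := (ev2 iota p x y).
Hypothesis q0 : q%:R = 0 :> F.
Hypothesis Hom : om ^+ 2 + om + 1 = 0.
(** The curve after division of [x] by [a] and of [y] by [b], where [om = a ^ m] and
    [b ^ (q + 1) = 1]. *)
Definition curve_poly : {poly F} := - (om ^+ 2 *: 'X^(2 * m) + om *: 'X^m).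
Hypothesis eqn : y ^+ q.+1 = evx curve_poly.
Hypothesis gen : generated iota x y.
Hypothesis x1 : x - 1 != 0.

Definition centered (w : K -> int) := vge w 1 (x - 1) /\ vge w 1 (y - 1).

Definition at11 (p : {poly {poly F}}) : F := p.[1].[1].

Lemma at11M p r : at11 (p * r) = at11 p * at11 r.
Proof. by rewrite /at11 !hornerM. Qed.

Lemma at11_1 : at11 1 = 1.
Proof. by rewrite /at11 !hornerC. Qed.

Lemma at11_decomp p : exists p1 p2,
  p = p1 * ('X - 1)%:P + p2 * ('X - 1) + (at11 p)%:P%:P.
Proof.
have /factor_theorem[p2 Hp2] : root (p - p.[1]%:P) 1.
  by rewrite rootE hornerD hornerN hornerC subrr.
have /factor_theorem[f Hf] : root (p.[1] - p.[1].[1]%:P) 1.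
  by rewrite rootE hornerD hornerN hornerC subrr.
exists f%:P, p2; rewrite -polyCM -[LHS](subrK p.[1]%:P) Hp2 -polyC1.
by rewrite -{1}(subrK p.[1].[1]%:P p.[1]) Hf polyCD polyC1 -addrA [p2 * _ + _]addrCA addrA.
Qed.

Lemma ev_at11 p : exists p1 p2, ev p = ev p1 * (x - 1) + ev p2 * (y - 1) + iota (at11 p).
Proof.
have [p1 [p2 Hp]] := at11_decomp p; exists p1, p2.
rewrite {1}Hp !ev2D !ev2M !ev2C map_polyC hornerC.
by rewrite ev2D ev2N ev2X ev2_1 rmorphB /= map_polyX rmorph1 !hornerE.
Qed.

Section Centered.
Variable w : K -> int.
Hypotheses (plw : is_place iota w) (cw : centered w).

Lemma centered_ev p : vge w 0 (ev p).
Proof.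
have vx : vge w 0 x.
  by rewrite -(subrK 1 x); apply: (vgeD plw); [apply: vgeW cw.1 | apply: (vge1 plw)].
have vy : vge w 0 y.
  by rewrite -(subrK 1 y); apply: (vgeD plw); [apply: vgeW cw.2 | apply: (vge1 plw)].
rewrite (ev2E iota x y (leqnn _)); apply: (vge_sum plw) => j _.
rewrite -(addr0 0); apply: (vgeM plw); last by rewrite -(mul0rn _ j); apply: (vgeX plw).
rewrite horner_coef; apply: (vge_sum plw) => i _; rewrite -(addr0 0).
apply: (vgeM plw); last by rewrite -(mul0rn _ i); apply: (vgeX plw).
by rewrite coef_map; apply: (vge_iota plw).
Qed.

Lemma centered_unit p : at11 p != 0 -> veq w 0 (ev p).
Proof.
move=> p0; have [p1 [p2 ->]] := ev_at11 p; rewrite addrC; apply: (veqD plw).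
  exact: (veq_iota plw).
by rewrite add0r; apply: (vgeD plw); rewrite -(add0r 1); apply: (vgeM plw);
  (apply: centered_ev || apply: cw.1 || apply: cw.2).
Qed.

End Centered.

Lemma curve_poly1 : curve_poly.[1] = 1.
Proof.
rewrite /curve_poly hornerN hornerD !hornerZ !hornerXn !expr1n !mulr1.
by rewrite -[LHS]addr0 -Hom; ring.
Qed.

Variable vP : K -> int.
Hypotheses (plP : is_place iota vP) (cP : centered vP).

(** The difference [y ^ (q + 1) - 1] is [(y - 1) U] with [U(1, 1) = q + 1 = 1], and also a multiple
    of [x - 1]. So a function vanishing at [(1, 1)] is divisible by [x - 1] up to such a unit; each
    division lowers the value at [vP], so the process stops. *)
Lemma local_factor p : ev p != 0 -> exists k s t, [/\ at11 s != 0, at11 t != 0 &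
  ev p * ev s = (x - 1) ^+ k * ev t].
Proof.
have [V HV] : exists V, curve_poly - 1 = V * ('X - 1%:P).
  by apply/factor_theorem; rewrite rootE hornerD curve_poly1 hornerN hornerC subrr.
pose U : {poly {poly F}} := \sum_(i < q.+1) 'X^i.
have at11U : at11 U = 1.
  rewrite /at11 horner_sum (eq_bigr (fun=> 1)) => [|i _]; last by rewrite hornerXn expr1n.
  by rewrite sumr_const card_ord -natr1 -polyC_natr q0 add0r hornerC.
have HUV : (y - 1) * ev U = (x - 1) * ev V%:P.
  have -> : (y - 1) * ev U = ev (('X - 1) * U) by rewrite ev2M ev2D ev2N ev2X ev2_1.
  rewrite -subrX1 ev2D ev2N ev2_1 ev2C.
  have -> : ev 'X^(q.+1) = y ^+ q.+1 by rewrite /ev2 map_polyXn hornerXn -polyC_exp hornerC.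
  have := congr1 (fun f => evx f) HV; rewrite rmorphB rmorphM /= rmorph1 hornerD -eqn hornerM hornerN hornerC => ->.
  by rewrite rmorphB /= map_polyX map_polyC /= rmorph1 hornerD hornerN hornerX hornerC mulrC.
have [N] := ubnP `|vP (ev p)|%N; elim: N p => // N IHN p le_N p0.
have [a0|a0] := eqVneq (at11 p) 0; last first.
  by exists 0%N, 1, p; split; [rewrite at11_1 oner_neq0 | exact: a0 | rewrite ev2_1 mulr1 mul1r].
have [p1 [p2 Ep]] := ev_at11 p; rewrite a0 rmorph0 addr0 in Ep.
have E : ev p * ev U = (x - 1) * ev (p1 * U + p2 * V%:P).
  rewrite Ep ev2D !ev2M mulrDl -!mulrA HUV; ring.
have U0 := centered_unit plP cP (p := U); rewrite at11U in U0.
have {}U0 := U0 (oner_neq0 _); have [Un0 vU] := U0.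
have nz : (x - 1) * ev (p1 * U + p2 * V%:P) != 0 by rewrite -E mulf_neq0.
have p'0 : ev (p1 * U + p2 * V%:P) != 0.
  by move: nz; rewrite mulf_eq0 negb_or => /andP[].
have vE : vP (ev p) = vP (x - 1) + vP (ev (p1 * U + p2 * V%:P)).
  by rewrite -(placeM plP) // -E (placeM plP) // vU addr0.
have ge1 : 1 <= vP (x - 1) by case: cP => -[/eqP|//]; rewrite (negPf x1).
have ge0 : 0 <= vP (ev (p1 * U + p2 * V%:P)).
  by case: (centered_ev plP cP (p1 * U + p2 * V%:P)) => [/eqP|//]; rewrite (negPf p'0).
have [|k [s [t [s0 t0 Hst]]]] := IHN _ _ p'0; first by move: le_N; rewrite vE; lia.
exists k.+1, (U * s), t; split=> //; first by rewrite at11M mulf_neq0 // at11U oner_neq0.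
by rewrite ev2M mulrA E -mulrA Hst mulrA -exprS.
Qed.

Lemma centered_value p : ev p != 0 -> exists k : nat, forall w, is_place iota w -> centered w ->
  w (ev p) = w (x - 1) *+ k.
Proof.
move=> p0; have [k [s [t [s0 t0 E]]]] := local_factor p0; exists k => w plw cw.
have [sn vs] := centered_unit plw cw s0; have [tn vt] := centered_unit plw cw t0.
have -> : w (ev p) = w (ev p * ev s) by rewrite (placeM plw) // vs addr0.
by rewrite E (placeM plw) ?expf_neq0 // vt addr0 (placeX plw).
Qed.

(** All values of [w] are multiples of [w (x - 1)], and one of them is 1. *)
Lemma centered_uniformizer w : is_place iota w -> centered w -> veq w 1 (x - 1).
Proof.
move=> plw cw; have [_ _ _ [t [t0 wt]]] := plw.
have [p [r [r0 Et]]] := gen t.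
have p0 : ev p != 0 by apply: contra_neq t0 => p0; rewrite Et p0 mul0r.
have [k Hk] := centered_value p0; have [l Hl] := centered_value r0.
move: wt; rewrite Et (placeM plw) ?invr_eq0 // (placeV plw) // (Hk w) // (Hl w) //.
case: cw => -[/eqP|ge1 _]; first by rewrite (negPf x1).
move: ge1 => ge1 H; split=> //; move: ge1 H; move: (w (x - 1)) => d ge1.
rewrite -(mulr_natr d k) -(mulr_natr d l) -mulrBr; move: (k%:R - l%:R) => e de.
have d0 : 0 < d by rewrite gtz0_ge1.
have e1 : 1 <= e by rewrite -gtz0_ge1 -(pmulr_rgt0 e d0) de.
by apply/eqP; rewrite eq_le ge1 andbT -[X in _ <= X]de ler_peMr // ltW.
Qed.

(** The exponent in [centered_value] is the same for all places centred at [(1, 1)]. *)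
Lemma centered_unique w : is_place iota w -> centered w -> same_place vP w.
Proof.
move=> plw cw f f0; have [p [r [r0 E]]] := gen f.
have p0 : ev p != 0 by apply: contra_neq f0 => p0; rewrite E p0 mul0r.
have [k Hk] := centered_value p0; have [l Hl] := centered_value r0.
have [_ uP] := centered_uniformizer plP cP; have [_ uw] := centered_uniformizer plw cw.
rewrite E !(placeM plP, placeM plw) ?invr_eq0 // !(placeV plP, placeV plw) //.
by rewrite !(Hk, Hl) // uP uw.
Qed.

End LocalRing.

(** * Orders at P and regularity elsewhere *)

Section Curve.
Variables (q m : nat) (F K : fieldType) (iota : {rmorphism F -> K}) (x y : K) (om : F).
Notation evx f := (map_poly iota f).[x].
Hypothesis q5 : (5 <= q)%N.
Hypothesis Hm : (3 * m = q.+1)%N.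
Hypothesis frob : forall u v : K, (u + v) ^+ q = u ^+ q + v ^+ q.
Hypothesis q0 : q%:R = 0 :> F.
Hypothesis Hom : om ^+ 2 + om + 1 = 0.
Hypothesis omq : om ^+ q = om ^+ 2.
Hypothesis tr : forall f : {poly F}, f != 0 -> evx f != 0.
Hypothesis gen : generated iota x y.
Hypothesis eqn : y ^+ q.+1 = evx (curve_poly m om).
Variable vP : K -> int.
Hypotheses (plP : is_place iota vP) (cP : centered x y vP).

Local Notation W := (iota om).

Lemma om_K : W ^+ 2 + W + 1 = 0.
Proof. by rewrite -rmorphXn -rmorphD -(rmorph1 iota) -rmorphD Hom rmorph0. Qed.

Lemma om_Kq : W ^+ q = W ^+ 2.
Proof. by rewrite -!rmorphXn omq. Qed.

Lemma three_m : 3 * m%:R = 1 :> K.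
Proof.
by rewrite -natrM Hm -natr1 -(rmorph_nat iota) q0 rmorph0 add0r.
Qed.

Lemma x_neq0 : x != 0.
Proof. by have := tr (negbT (polyX_eq0 F)); rewrite map_polyX hornerX. Qed.

Lemma x1_neq0 : x - 1 != 0.
Proof.
have := tr (negbT (polyXsubC_eq0 (1 : F))).
by rewrite rmorphB /= map_polyX map_polyC /= rmorph1 !hornerE.
Qed.

Lemma y_neq0 : y != 0.
Proof.
have : curve_poly m om != 0.
  by apply: contra_eq_neq (curve_poly1 m Hom) => ->; rewrite horner0 eq_sym oner_neq0.
by move/tr; rewrite -eqn expf_eq0.
Qed.

Lemma eqnE : y ^+ q.+1 = - (W ^+ 2 * x ^+ (2 * m) + W * x ^+ m).
Proof.
rewrite eqn /curve_poly rmorphN rmorphD /= !map_polyZ /= !map_polyXn.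
by rewrite hornerN hornerD !hornerZ !hornerXn rmorphXn.
Qed.

Definition zf := y ^+ 3 / x.
Local Notation z := zf.
Local Notation h := (tangent x z 1 y).
Local Notation R1 := (lin1 W x z 1).
Local Notation R2 := (lin2 W x z 1).
Local Notation S3 := (x + z + 1).
Local Notation cof := (cofactor x z 1 y).

Lemma surf : x * z * 1 = y ^+ 3.
Proof. by rewrite mulr1 mulrC divfK ?x_neq0. Qed.

Lemma W3 : W * W ^+ 2 = 1.
Proof.
have -> : W * W ^+ 2 = 1 + (W ^+ 2 + W + 1) * (W - 1) by ring.
by rewrite om_K mul0r addr0.
Qed.

Lemma fermat : W * x ^+ m + W ^+ 2 * z ^+ m + 1 ^+ m = 0.
Proof.
have xm : x ^+ m != 0 by rewrite expf_neq0 ?x_neq0.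
apply: (mulIf xm); rewrite mul0r.
have -> : (W * x ^+ m + W ^+ 2 * z ^+ m + 1 ^+ m) * x ^+ m
   = W * x ^+ m * x ^+ m + x ^+ m + W ^+ 2 * (x * z * 1) ^+ m.
  by rewrite !exprMn !expr1n; ring.
rewrite surf -exprM Hm eqnE mul2n -addnn exprD.
have -> : W ^+ 2 * - (W ^+ 2 * (x ^+ m * x ^+ m) + W * x ^+ m)
  = - ((W * W ^+ 2) * W * x ^+ m * x ^+ m + (W * W ^+ 2) * x ^+ m) by ring.
by rewrite W3; ring.
Qed.

(** The three terms of [fermat] have sum 0, so their cubes add up to three times their product,
    which is [(x z) ^ m = y ^ (q + 1)]. *)
Lemma hermitian : x ^+ q.+1 + z ^+ q.+1 + 1 ^+ q.+1 = 3 * y ^+ q.+1.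
Proof.
have W33 : W ^+ 3 = 1 by rewrite -W3; ring.
have W63 : W ^+ 2 ^+ 3 = 1 by rewrite exprAC W33 expr1n.
have := fermat; have := surf; move: zf => Z surfZ; rewrite expr1n => /hermitian_cubic.
rewrite [(W * _) ^+ 3]exprMn [(W ^+ 2 * _) ^+ 3]exprMn W33 W63 !mul1r -Hm mulnC !exprM !expr1n => ->.
rewrite [y ^+ m ^+ 3]exprAC -surfZ [(x * Z * 1) ^+ m]exprMn [(x * Z) ^+ m]exprMn !expr1n mulr1.
by rewrite -[RHS]mulr1 -W3; ring.
Qed.

Lemma om_neq1 : 1 - om != 0.
Proof.
apply/eqP => H1; have Eo : om = 1 by apply/esym/eqP; rewrite -subr_eq0 H1.
have := three_m; have := om_K; rewrite Eo rmorph1 expr1n => H3.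
rewrite (_ : (3 : K) = 1 + 1 + 1); last by ring.
by rewrite H3 mul0r => /esym/eqP; rewrite oner_eq0.
Qed.

Lemma om_neq0 : om != 0.
Proof.
by apply: contra_eq_neq Hom => ->; rewrite expr0n !add0r oner_neq0.
Qed.

Lemma three_neq0 : 3%:R != 0 :> F.
Proof.
have := three_m; rewrite -(rmorph_nat iota 3); apply: contra_eq_neq => ->.
by rewrite rmorph0 mul0r eq_sym oner_neq0.
Qed.

Lemma m_neq0 : m%:R != 0 :> F.
Proof.
have := three_m; rewrite -(rmorph_nat iota m); apply: contra_eq_neq => ->.
by rewrite rmorph0 mulr0 eq_sym oner_neq0.
Qed.

Lemma vx1 : veq vP 1 (x - 1).
Proof. exact: (centered_uniformizer q0 Hom eqn gen x1_neq0 plP cP). Qed.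

Lemma veq_shift u : vge vP 1 (u - 1) -> veq vP 0 u.
Proof.
move=> Hu; rewrite -(subrK 1 u) addrC; apply: (veqD plP); first exact: (veq1 plP).
by rewrite add0r.
Qed.

Lemma vx : veq vP 0 x. Proof. by apply: veq_shift; case: cP. Qed.
Lemma vy : veq vP 0 y. Proof. by apply: veq_shift; case: cP. Qed.

Lemma vge_pow1 u k : vge vP 1 (u - 1) -> vge vP 1 (\sum_(i < k) u ^+ i - k%:R).
Proof.
move=> Hu; elim: k => [|k IHk]; first by rewrite big_ord0 subrr; apply: vge0.
rewrite big_ord_recr /= -natr1 opprD addrACA; apply: (vgeD plP) => //.
rewrite subrX1 -(addr0 1); apply: (vgeM plP) => //; apply: (vge_sum plP) => i _.
by rewrite -(mul0rn _ i); apply: (vgeX plP); apply/veq_vge/veq_shift.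
Qed.

Lemma vz1 : vge vP 1 (z - 1).
Proof.
rewrite (_ : z - 1 = x^-1 * ((y - 1) * (y ^+ 2 + y + 1) - (x - 1))); last first.
  by rewrite /zf; field; apply: x_neq0.
rewrite -(add0r 1); apply: (vgeM plP).
  by have := veqV plP vx; rewrite oppr0 => /veq_vge.
apply: (vgeB plP); last by case: cP.
rewrite -(addr0 1); apply: (vgeM plP); first by case: cP.
have yg := veq_vge vy; apply: (vgeD plP); last exact: (vge1 plP).
by apply: (vgeD plP) => //; rewrite -(mul0rn _ 2); apply: (vgeX plP).
Qed.

Lemma vz : veq vP 0 z. Proof. exact: veq_shift vz1. Qed.

Lemma veq_natK k : k%:R != 0 :> F -> veq vP 0 (k%:R).
Proof. by rewrite -(rmorph_nat iota); apply: (veq_iota plP). Qed.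

Lemma vW : veq vP 0 W. Proof. exact: (veq_iota plP) om_neq0. Qed.

Lemma R2E : R2 = (x - 1) + W * (z - 1).
Proof.
rewrite /lin2; transitivity (x - 1 + W * (z - 1) + (W ^+ 2 + W + 1)); first by ring.
by rewrite om_K addr0.
Qed.

(** [R2 = 0] is the tangent line to the Fermat curve in the coordinates [x], [z]: the linear part of
    [fermat] at [P] is [W m R2]. *)
Lemma vgeR2 : vge vP 2 R2.
Proof.
have E : W * m%:R * R2 = - (W * ((x - 1) * (\sum_(i < m) x ^+ i - m%:R))
    + W ^+ 2 * ((z - 1) * (\sum_(i < m) z ^+ i - m%:R))).
  have : W * (x ^+ m - 1) + W ^+ 2 * (z ^+ m - 1) = 0.
    transitivity (W * x ^+ m + W ^+ 2 * z ^+ m + 1 ^+ m - (W ^+ 2 + W + 1)).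
      by rewrite expr1n; ring.
    by rewrite fermat om_K subrr.
  rewrite !subrX1 R2E; move: (\sum_(i < m) x ^+ i) (\sum_(i < m) z ^+ i) => a b E.
  rewrite -[RHS]addr0 -E; ring.
have : vge vP 2 (W * m%:R * R2).
  have W0 := veq_vge vW.
  rewrite E; apply: (vgeN plP); apply: (vgeD plP).
    rewrite -[2]add0r; apply: (vgeM plP) => //; rewrite -[2]/(1 + 1).
    by apply: (vgeM plP); [case: cP | apply: vge_pow1; case: cP].
  rewrite -[2]add0r; apply: (vgeM plP); first by rewrite -(mul0rn _ 2); apply: (vgeX plP).
  by rewrite -[2]/(1 + 1); apply: (vgeM plP); [apply: vz1 | apply: vge_pow1; apply: vz1].
have Wm : veq vP 0 (W * m%:R).
  by rewrite -(addr0 0); apply: (veqM plP); [apply: vW | apply: veq_natK m_neq0].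
by move/(vge_divl plP)/(_ Wm); rewrite subr0.
Qed.

Lemma vR1 : veq vP 1 R1.
Proof.
have -> : R1 = (1 - W) * (x - 1) + W * R2.
  rewrite R2E /lin1; transitivity ((1 - W) * (x - 1) + W * (x - 1 + W * (z - 1)) + (W ^+ 2 + W + 1)).
    by ring.
  by rewrite om_K addr0.
apply: (veqD plP).
  rewrite -(add0r 1); apply: (veqM plP); last exact: vx1.
  by rewrite -(rmorph1 iota) -rmorphB; apply: (veq_iota plP); apply: om_neq1.
by rewrite -[1 + 1]add0r; apply: (vgeM plP); [apply: veq_vge vW | apply: vgeR2].
Qed.

Lemma vge_h1 : vge vP 1 h.
Proof.
rewrite (_ : h = (x - 1) + (z - 1) - 3 * (y - 1)); last by rewrite /tangent; ring.
apply: (vgeB plP); first by apply: (vgeD plP); [case: cP | apply: vz1].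
by rewrite -(add0r 1); apply: (vgeM plP); [apply: (vge_nat plP 3) | case: cP].
Qed.

Lemma v3y : veq vP 0 (3 * y).
Proof. by rewrite -(addr0 0); apply: (veqM plP); [apply: (veq_natK three_neq0) | apply: vy]. Qed.

Lemma S3E : S3 = 3 * y + h. Proof. by rewrite /tangent; ring. Qed.

(** By additivity of the [q]-th power [(Y + H) ^ (q + 1) - Y ^ (q + 1)] is [H e] with a unit [e], so
    [H] has the order of [r1 ^ (q + 1)]. *)
Lemma tangent_order (Y H r1 r2 : K) : veq vP 0 Y -> vge vP 1 H -> veq vP 1 r1 -> vge vP 2 r2 ->
  (Y + H) ^+ q.+1 + r1 ^+ q.+1 + r2 ^+ q.+1 = Y ^+ q.+1 -> veq vP q.+1%:R H.
Proof.
move=> vY vH vr1 vr2 E.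
pose e := Y ^+ q + H ^+ q.-1 * (Y + H).
have Hq : H ^+ q = H * H ^+ q.-1 by rewrite -exprS prednK //; lia.
have E2 : H * e = - (r1 ^+ q.+1 + r2 ^+ q.+1).
  transitivity ((Y + H) ^+ q.+1 - Y ^+ q.+1).
    by rewrite !(exprS _ q) frob /e Hq; ring.
  by rewrite -E; ring.
have ve : veq vP 0 e.
  apply: (veqD plP); first by rewrite -(mul0rn _ q); apply: (veqX plP).
  rewrite add0r -(addr0 1); apply: (vgeM plP).
    by apply: vgeW (vgeX plP q.-1 vH); rewrite natz; lia.
  apply: (vgeD plP); first exact: veq_vge.
  by apply: vgeW vH.
have vE : veq vP q.+1%:R (H * e).
  rewrite E2; apply: (veqN plP); apply: (veqD plP); first exact: (veqX plP _ vr1).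
  apply: vgeW (vgeX plP q.+1 vr2); rewrite -[2 *+ _]mulr_natr !natz; lia.
have -> : H = H * e * e^-1 by case: ve => e0 _; rewrite mulfK.
by rewrite -[X in veq _ X _]addr0 -[X in _ + X]oppr0; apply: (veqM plP vE); apply: (veqV plP ve).
Qed.

Lemma vh : veq vP q.+1%:R h.
Proof.
have := hermitian_tangent om_K Hm frob om_Kq three_m hermitian; rewrite S3E.
exact: tangent_order v3y vge_h1 vR1 vgeR2.
Qed.

Lemma h_neq0 : h != 0. Proof. by case: vh. Qed.

Lemma vS3 : veq vP 0 (3 * S3).
Proof.
rewrite -(addr0 0); apply: (veqM plP); first exact: (veq_natK three_neq0).
by rewrite S3E; apply: (veqD plP); [apply: v3y | rewrite add0r; apply: vge_h1].
Qed.

Lemma vge_hk : vge vP q.+1%:R (h * cof).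
Proof.
rewrite -[X in vge _ X _]addr0; apply: (vgeM plP); first exact: veq_vge vh.
have y2 : vge vP 0 y := veq_vge vy; have h0 : vge vP 0 h by apply: vgeW vge_h1.
have [_ SD SM] := (vring_valring plP).1.
have SA u v : vge vP 0 u -> vge vP 0 v -> vge vP 0 (u + v) by apply: (vgeD plP).
rewrite /cofactor; apply: (SA); first apply: (SA).
- by apply: (SM); [apply: (vge_nat plP 27) | rewrite expr2; apply: (SM)].
- by do 2?[apply: (SM) => //]; apply: (vge_nat plP 9).
- by rewrite expr2; apply: (SM).
Qed.

Lemma nodal : R1 ^+ 3 + R2 ^+ 3 = 3 * S3 * R1 * R2 - h * cof.
Proof. exact: (nodal_cubic om_K surf). Qed.

(** In the equation of the nodal cubic [R2 ^ 3] and [h cof] have order above 3, so [3 S3 R1 R2] has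
    the order of [R1 ^ 3]. *)
Lemma vR2 : veq vP 2 R2.
Proof.
have E : R2 * (3 * S3 * R1) = R1 ^+ 3 + (R2 ^+ 3 + h * cof).
  by rewrite addrA nodal; ring.
have v3 : veq vP 3 (R2 * (3 * S3 * R1)).
  rewrite E; apply: (veqD plP); first exact: (veqX plP 3 vR1).
  apply: (vgeD plP); first by apply: vgeW (vgeX plP 3 vgeR2).
  by apply: vgeW vge_hk; rewrite natz; lia.
have vSR : veq vP 1 (3 * S3 * R1) by rewrite -(add0r 1); apply: (veqM plP vS3 vR1).
have -> : R2 = R2 * (3 * S3 * R1) / (3 * S3 * R1) by case: vSR => e0 _; rewrite mulfK.
exact: (veqM plP v3 (veqV plP vSR)).
Qed.

(** Divided by the dominant one among [x], [z], 1, called [t], the coordinates are integral, [y] by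
    the surface equation. By [tangent_residue], [h / t] is a unit unless the place is centred at
    [P], so [h] may replace [t]. *)
Lemma regular_coordinates w : is_place iota w -> ~ same_place vP w ->
  [/\ vge w 0 (1 / h), vge w 0 (x / h), vge w 0 (z / h) & vge w 0 (y / h)].
Proof.
move=> plw ne_w; have vrw := vring_valring plw; have rw := vrw.1.
pose E (i : 'I_3) := if i == 0 :> nat then x else if i == 1%N :> nat then z else 1.
have [|e [e_mem e0 He]] := exists_dominant vrw (mem_enum predT (ord0 : 'I_3)) (E := E).
  exact: x_neq0.
set t := E e in e0 He.
have Sx : valring w (x / t) by apply: (He (@Ordinal 3 0 isT)); rewrite mem_enum.
have Sz : valring w (z / t) by apply: (He (@Ordinal 3 1 isT)); rewrite mem_enum.
have S1 : valring w (1 / t) by apply: (He (@Ordinal 3 2 isT)); rewrite mem_enum.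
have surf_t : x / t * (z / t) * (1 / t) = (y / t) ^+ 3.
  by rewrite expr_div_n -surf; field; rewrite e0.
have SD : valring w (y / t).
  have d0 : y / t != 0 by rewrite mulf_neq0 ?invr_eq0 ?y_neq0.
  have [//|Sd'] := vrw.2 _ d0.
  rewrite (_ : y / t = (y / t) ^+ 3 * ((y / t)^-1 * (y / t)^-1)).
    have SM := ring_setM rw; rewrite -surf_t; apply: (SM); last exact: (SM).
    by apply: (SM) => //; apply: (SM).
  by move: (y / t) d0 => d d0; field.
have fermat_t : W * (x / t) ^+ m + W ^+ 2 * (z / t) ^+ m + (1 / t) ^+ m = 0.
  rewrite -[RHS](mul0r (t ^+ m)^-1) -fermat; move: zf => Z.
  by rewrite !expr_div_n; ring.
have tangent_t : tangent (x / t) (z / t) (1 / t) (y / t) = h / t.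
  by rewrite /tangent; ring.
have h0 := h_neq0.
have nM : ~ maxid (valring w) (h / t).
  rewrite -tangent_t => Mh.
  have [] := tangent_residue om_K surf_t Hm frob om_Kq three_m vrw _ Sx Sz S1 SD fermat_t Mh.
    exact: (vge_iota plw).
  set d := y / t in SD * => MA MB MC.
  (* One of the three scaled coordinates is 1 itself. *)
  have M1d : maxid (valring w) (1 - d).
    have : t = x \/ t = z \/ t = 1.
      by rewrite /t /E; case: ifP => _; [left | case: ifP => _; right; [left | right]].
    case=> [tE|[tE|tE]].
    - by move: MA; rewrite tE divff // x_neq0.
    - by move: MB; rewrite tE divff // -tE.
    - by move: MC; rewrite tE divff // oner_neq0.
  have UC : vunit (valring w) (1 / t).
    apply: vunitP => // MC1; apply: (maxid1 vrw).
    rewrite (_ : 1 = (1 - d) - ((1 / t) - d) + 1 / t); last by ring.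
    by apply: maxidD => //; apply: maxidB.
  apply: ne_w; apply: (centered_unique q0 Hom eqn gen x1_neq0 plP cP plw).
  have [_ _ St] := UC; rewrite invf_div divr1 in St.
  split; apply/(maxid_valring plw).
    rewrite (_ : x - 1 = t * ((x / t - d) - (1 / t - d))); last by field.
    by apply: maxidMr => //; apply: maxidB.
  rewrite (_ : y - 1 = - (t * (1 / t - d))); last by rewrite /d; field.
  by apply: maxidN => //; apply: maxidMr.
have Sth : valring w (t / h).
  rewrite -invf_div; apply: contrapT => nS; apply: nM; right => //.
have scale u : valring w (u / t) -> valring w (u / h).
  move=> Su; rewrite (_ : u / h = u / t * (t / h)); last by rewrite mulrA divfK.
  exact: ring_setM.
by split; apply: scale.
Qed.

(* With [t ^ 3 = R2 ^ 2 / R1] on the nodal cubic, [psi i] is the form of degree [i + 1] that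
   restricts to [t ^ (3 i + 2)]. *)
Fixpoint psi i : K :=
  match i with
  | 0 => R2
  | 1 => 3 * S3 * R2 - R1 ^+ 2
  | (i'.+1 as j).+1 => 3 * S3 * psi j - R1 * R2 * psi i'
  end.

Lemma psiS i : psi i.+2 = 3 * S3 * psi i.+1 - R1 * R2 * psi i.
Proof. by []. Qed.

(** On the nodal cubic the recurrence has the characteristic roots [R2 ^ 2 / R1] and [R1 ^ 2 / R2],
    of sum [3 S3] and product [R1 R2], and [psi] follows the first, of order 3 at [P]. Off the cubic
    this holds up to order [q + 1], and [i + 2 <= m] keeps the orders in play below that. *)
Lemma v_psi i : (i + 2 <= m)%N ->
  veq vP (3 * i + 2)%:R (psi i) /\ vge vP q.+1%:R (R1 * psi i.+1 - R2 ^+ 2 * psi i).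
Proof.
elim: i => [|i IHi] le_im.
  split; first exact: vR2.
  rewrite (_ : _ - _ = h * cof); first exact: vge_hk.
  have -> : h * cof = 3 * S3 * R1 * R2 - (R1 ^+ 3 + R2 ^+ 3) by rewrite nodal; ring.
  by rewrite /=; ring.
have [vi ve] := IHi (leq_trans (leq_addl 1 _) le_im).
have vR2X := veqX plP 2 vR2.
have vpsi : veq vP (3 * i.+1 + 2)%:R (psi i.+1).
  have vRp : veq vP (3 * i + 6)%:R (R1 * psi i.+1).
    rewrite -(subrK (R2 ^+ 2 * psi i) (R1 * psi i.+1)) addrC; apply: (veqD plP).
      rewrite (_ : (3 * i + 6)%:R = 2 *+ 2 + (3 * i + 2)%:R); last by rewrite !natz; lia.
      exact: (veqM plP vR2X vi).
    by apply: vgeW ve; rewrite !natz; lia.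
  have -> : psi i.+1 = R1 * psi i.+1 / R1 by case: vR1 => r0 _; rewrite mulrAC divff ?mul1r.
  rewrite (_ : (3 * i.+1 + 2)%:R = (3 * i + 6)%:R + - 1); last by rewrite !natz; lia.
  exact: (veqM plP vRp (veqV plP vR1)).
split=> //.
(* The order 2 lost in the division by [R2] is regained from [R1 ^ 2] in one term and from [psi] in
   the other. *)
have E : R2 * (R1 * psi i.+2 - R2 ^+ 2 * psi i.+1)
    = R1 ^+ 2 * (R1 * psi i.+1 - R2 ^+ 2 * psi i) + h * cof * psi i.+1.
  have -> : h * cof = 3 * S3 * R1 * R2 - (R1 ^+ 3 + R2 ^+ 3) by rewrite nodal; ring.
  by rewrite psiS; ring.
have : vge vP (2 + q.+1%:R) (R2 * (R1 * psi i.+2 - R2 ^+ 2 * psi i.+1)).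
  rewrite E; apply: (vgeD plP).
    apply: (vgeM plP) => //; exact: (veq_vge (veqX plP 2 vR1)).
  rewrite addrC; apply: (vgeM plP); first exact: vge_hk.
  by apply: vgeW (veq_vge vpsi); rewrite natz; lia.
by move/(vge_divl plP)/(_ vR2); rewrite [2 + _]addrC addrK.
Qed.

(** [psi i] is a form of degree [i + 1] in coordinates that are regular after division by [h]. *)
Lemma regular_psi w i : is_place iota w -> ~ same_place vP w -> vge w 0 (psi i / h ^+ i.+1).
Proof.
move=> plw ne_w; have [r1 rx rz ry] := regular_coordinates plw ne_w.
have [ring1 SB SM] := (vring_valring plw).1; have SD := ring_setD (vring_valring plw).1.
have SW : valring w W by apply: (vge_iota plw).
have SW2 : valring w (W ^+ 2) by rewrite expr2; apply: (SM).
have rR1 : valring w (R1 / h).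
  rewrite (_ : R1 / h = x / h + W ^+ 2 * (z / h) + W * (1 / h)); last by rewrite /lin1; ring.
  by apply: (SD); [apply: (SD) => //|]; apply: (SM).
have rR2 : valring w (R2 / h).
  rewrite (_ : R2 / h = x / h + W * (z / h) + W ^+ 2 * (1 / h)); last by rewrite /lin2; ring.
  by apply: (SD); [apply: (SD) => //|]; apply: (SM).
have rT : valring w (3 * S3 / h).
  rewrite (_ : 3 * S3 / h = 3 * (x / h + z / h + 1 / h)); last by ring.
  by apply: (SM); [apply: (vge_nat plw 3) | do 2?apply: (SD)].
have h0 := h_neq0.
suff : vge w 0 (psi i / h ^+ i.+1) /\ vge w 0 (psi i.+1 / h ^+ i.+2) by case.
elim: i => [|i [IH1 IH2]].
  split; first by rewrite expr1.
  rewrite (_ : psi 1 / h ^+ 2 = (3 * S3 / h) * (R2 / h) - (R1 / h) * (R1 / h)).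
    by apply: (SB); apply: (SM).
  by rewrite /=; move: h h0 => H H0; field.
split=> //; rewrite psiS.
rewrite (_ : _ / _ = (3 * S3 / h) * (psi i.+1 / h ^+ i.+2) - (R1 / h) * (R2 / h) * (psi i / h ^+ i.+1)).
  by apply: (SB); apply: (SM) => //; apply: (SM).
rewrite !exprS; have := expf_neq0 i h0; move: (h ^+ i) (psi i) (psi i.+1) => H p p' H0.
by field; rewrite H0 h0.
Qed.

End Curve.

(** * The largest gap *)

Lemma exists_irreducible_factor (F : fieldType) (f : {poly F}) : (1 < size f)%N ->
  exists pi, irreducible_poly pi /\ pi %| f.
Proof.
have [n] := ubnP (size f); elim: n f => // n IHn f le_fn f1.
have [irr|nirr] := pselect (irreducible_poly f); first by exists f.
have [g [g1 gf ngf]] : exists g : {poly F}, [/\ size g != 1%N, g %| f & ~~ (g %= f)].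
  apply: contrapT => no; apply: nirr; split=> // g g1 gf; apply/negPn/negP => ngf.
  by apply: no; exists g.
have f0 : f != 0 by rewrite -size_poly_gt0 ltnW.
have g0 : g != 0 by apply: contraNneq f0 => g0; move: gf; rewrite g0 dvd0p.
have gt1 : (1 < size g)%N by move: g1 g0; rewrite -size_poly_gt0; case: (size g) => [|[|]].
have lt_gf : (size g < size f)%N.
  by rewrite ltn_neqAle (dvdp_leq f0 gf) andbT; apply: contra ngf => E; rewrite -dvdp_size_eqp.
have [|pi [irr pig]] := IHn g _ gt1; first exact: leq_trans lt_gf _.
by exists pi; split=> //; apply: dvdp_trans gf.
Qed.

Lemma irreducible_dvd1 (F : fieldType) (pi : {poly F}) : irreducible_poly pi -> ~~ (pi %| 1).
Proof.
move=> irr; rewrite dvdp1; apply/negP => /eqP E.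
by have := irr.1; rewrite E.
Qed.

Lemma irreducible_dvdM (F : fieldType) (pi f g : {poly F}) : irreducible_poly pi ->
  ~~ (pi %| f) -> ~~ (pi %| g) -> ~~ (pi %| f * g).
Proof.
move=> irr nf ng; have cf : coprimep pi f by rewrite irreducible_poly_coprime.
by rewrite Gauss_dvdpr.
Qed.

(** * A totally ramified factor of the curve equation *)

Section BranchPolynomial.
Variables (F : fieldType) (om : F) (m : nat).
Hypotheses (om0 : om != 0) (m0 : m%:R != 0 :> F).

Definition branch_poly : {poly F} := om *: 'X^m + 1.

Let m_gt0 : (0 < m)%N.
Proof. by rewrite lt0n; apply: contra_neq m0 => ->. Qed.

Lemma size_branch_poly : (1 < size branch_poly)%N.
Proof.
rewrite /branch_poly size_polyDl ?size_polyC size_scale // size_polyXn //.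
by rewrite oner_eq0 ltnS.
Qed.

(** A repeated factor would divide both the polynomial [B] and its derivative [B'], hence
    [B - m^-1 X B' = 1]. *)
Lemma branch_simple pi g : irreducible_poly pi -> branch_poly = pi * g -> ~~ (pi %| g).
Proof.
move=> irr E; apply/negP => /dvdpP[g2 Eg].
suff : pi %| 1 by apply/negP/irreducible_dvd1.
have dvd' : pi %| branch_poly^`().
  rewrite E Eg !derivM mulrDr !mulrA.
  by do 2?apply: dvdp_add; by [rewrite dvdp_mull | rewrite -!mulrA dvdp_mulr].
have -> : 1 = branch_poly - m%:R^-1 *: ('X * branch_poly^`()).
  rewrite /branch_poly derivD derivZ derivXn -polyC1 derivC addr0.
  rewrite -scalerAr mulrnAr -exprS prednK // -scaler_nat scalerA mulrC.
  by rewrite scalerA divfK // addrAC subrr add0r.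
apply: dvdp_sub; first by rewrite E dvdp_mulIl.
by rewrite dvdpZr ?invr_eq0 // dvdp_mull.
Qed.

Lemma curve_polyE : curve_poly m om = branch_poly * (- om *: 'X^m).
Proof.
rewrite /curve_poly /branch_poly mul2n -addnn exprD -!mul_polyC rmorphN rmorphXn.
by ring.
Qed.

(** Provides the simple factor from which the independence of the powers of [y], and so the
    automorphisms, are obtained. *)
Lemma curve_poly_branch : exists pi g, [/\ irreducible_poly pi, curve_poly m om = pi * g
  & ~~ (pi %| g)].
Proof.
have [pi [irr /dvdpP[g Eg]]] := exists_irreducible_factor size_branch_poly.
rewrite mulrC in Eg; exists pi, (g * (- om *: 'X^m)); split=> //.
  by rewrite curve_polyE Eg mulrA.
apply: irreducible_dvdM => //; first exact: branch_simple Eg.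
apply/negP => dX; have : pi %| 1; last by apply/negP/irreducible_dvd1.
have -> : 1 = branch_poly + - om *: 'X^m by rewrite /branch_poly scaleNr addrAC subrr add0r.
by apply: dvdp_add => //; rewrite Eg dvdp_mulIl.
Qed.

End BranchPolynomial.

Section Gap.
Variables (q m : nat) (F K : fieldType) (iota : {rmorphism F -> K}) (x y : K) (om zeta : F).
Notation evx f := (map_poly iota f).[x].
Hypothesis q5 : (5 <= q)%N.
Hypothesis Hm : (3 * m = q.+1)%N.
Hypothesis frob : forall u v : K, (u + v) ^+ q = u ^+ q + v ^+ q.
Hypothesis q0 : q%:R = 0 :> F.
Hypothesis Hom : om ^+ 2 + om + 1 = 0.
Hypothesis omq : om ^+ q = om ^+ 2.
Hypothesis prim_zeta : q.+1.-primitive_root zeta.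
Hypothesis tr : forall f : {poly F}, f != 0 -> evx f != 0.
Hypothesis gen : generated iota x y.
Hypothesis eqn : y ^+ q.+1 = evx (curve_poly m om).
Variable vP : K -> int.
Hypotheses (plP : is_place iota vP) (cP : centered x y vP).

Local Notation h := (tangent x (zf x y) 1 y).
Let x0 : x != 0 := x_neq0 tr.
Let y0 : y != 0 := y_neq0 Hom tr eqn.
Let x10 : x - 1 != 0 := x1_neq0 tr.
Let m0 : m%:R != 0 :> F := m_neq0 iota Hm q0.
Let om0 : om != 0 := om_neq0 Hom.
Let bx : K := evx (branch_poly om m).

Let bx0 : bx != 0.
Proof.
by apply: tr; rewrite -size_poly_gt0 ltnW // size_branch_poly.
Qed.

Let eqn_bx : y ^+ q.+1 = bx * (- iota om * x ^+ m).
Proof.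
rewrite eqn curve_polyE rmorphM hornerM /bx; congr (_ * _).
by rewrite /= map_polyZ /= map_polyXn hornerZ hornerXn rmorphN.
Qed.

Let bxE : bx = iota om * x ^+ m + 1.
Proof.
by rewrite /bx /branch_poly rmorphD rmorph1 /= map_polyZ /= map_polyXn hornerD hornerZ hornerXn hornerC.
Qed.

Lemma place_y w : is_place iota w -> w y *+ q.+1 = w bx + w x *+ m.
Proof.
move=> plw; rewrite -(placeX plw) // eqn_bx.
have o0 : - iota om != 0 by rewrite oppr_eq0 fmorph_eq0.
rewrite !(placeM plw) ?mulf_neq0 ?expf_neq0 // (placeX plw) //.
by rewrite (placeN plw) (place_iota plw) // add0r.
Qed.

(** At a zero of [x] the factor [bx] of [y ^ (q + 1)] is a unit, at a pole it has the value of
    [x ^ m]; then [q + 1 = 3 m] gives the ratios. *)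
Lemma place_cases w : is_place iota w ->
  [/\ w x = 0 -> 0 <= w y, 0 < w x -> 3 * w y = w x & w x < 0 -> 3 * w y = 2 * w x].
Proof.
move=> plw; have wy := place_y plw; have vW := veq_iota plw om0.
have vx : veq w (w x) x by split.
have vox : veq w (w x *+ m) (iota om * x ^+ m).
  by rewrite -[X in veq _ X _]add0r; apply: (veqM plw vW (veqX plw m vx)).
have m_gt0 : (0 < m)%N by lia.
split=> Hx.
- have : vge w 0 bx.
    rewrite bxE; apply: (vgeD plw); last exact: (vge1 plw).
    by have := veq_vge vox; rewrite Hx mul0rn.
  case=> [/eqP|]; first by rewrite (negPf bx0).
  by move: wy; rewrite Hx mul0rn addr0 => <-; rewrite pmulrn_lge0.
- have [_ wb] : veq w 0 bx.
    rewrite bxE addrC; apply: (veqD plw (veq1 plw)); apply: vgeW (veq_vge vox).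
    by rewrite add0r -gtz0_ge1 pmulrn_lgt0.
  move: wy; rewrite wb add0r -Hm mulrnA => /(pmulrnI m_gt0) <-.
  by rewrite mulr_natl.
- have [_ wb] : veq w (w x *+ m) bx.
    rewrite bxE; apply: (veqD plw vox); apply: vgeW (vge1 plw).
    by rewrite lezD1 pmulrn_llt0.
  move: wy; rewrite wb -mulrnDl -Hm mulrnA => /(pmulrnI m_gt0) E.
  by rewrite mulr_natl E mulr_natl mulr2n.
Qed.

Variable f : K.
Hypothesis f0 : f != 0.
Hypothesis f_reg : forall w, is_place iota w -> ~ same_place vP w -> 0 <= w f.
Hypothesis f_pole : vP f = - ((m.-1 * q.+1).+1)%:Z.

(* [x ^ (m - 1) dx / y ^ q] is the differential with divisor [(m - 1) D], where [D] is the
   polar divisor of [x], so that [Psi dx / (x - 1)] is regular away from [P]. *)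
Definition Psi : K := f * h ^+ m.-1 * x ^+ m.-1 * (x - 1) / y ^+ q.

Let h0 : h != 0 := h_neq0 q5 Hm frob q0 Hom omq tr gen eqn plP cP.

Lemma place_Psi w : is_place iota w ->
  w Psi = w f + w h *+ m.-1 + w x *+ m.-1 + w (x - 1) - w y *+ q.
Proof.
move=> plw; rewrite /Psi !(placeM plw) ?(placeV plw) ?(placeX plw) ?(mulf_neq0, expf_neq0, invr_eq0) //.
Qed.

Lemma Psi_neq0 : Psi != 0.
Proof. by rewrite /Psi !mulf_neq0 ?invr_eq0 ?expf_neq0. Qed.

(** The assumed pole of [f] is cancelled by [h ^ (m - 1)] and the simple zero of [x - 1]. *)
Lemma vP_Psi : vP Psi = 0.
Proof.
rewrite (place_Psi plP) f_pole.
have [_ ->] := vh q5 Hm frob q0 Hom omq tr gen eqn plP cP.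
have [_ ->] := vx plP cP; have [_ ->] := vy plP cP.
have [_ ->] := vx1 q0 Hom tr gen eqn plP cP.
by rewrite !mul0rn; lia.
Qed.

(** A rational function of [x] has values divisible by [(q + 1) w(y)] at zeros of [branch_poly], and
    by [3 w(y)] at zeros of [x]. The bounds [- q w(y)] and [- 2 w(y)] thus forbid it a pole
    there. *)
Lemma Psi_bounds w : is_place iota w ->
  [/\ w x = 0 -> - (w y *+ q) <= w Psi,
      0 < w x -> - (2 * w y) <= w Psi,
      w x < 0 -> 0 < w Psi
    & ~ same_place vP w -> w x = 0 -> w y = 0 -> w (x - 1) <= w Psi].
Proof.
move=> plw; have [cx0 cx1 cx2] := place_cases plw.
have [same|ne] := pselect (same_place vP w).
  have wx : w x = 0 by rewrite -same //; have [] := vx plP cP.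
  have wy : w y = 0 by rewrite -same //; have [] := vy plP cP.
  have wP : w Psi = 0 by rewrite -same ?vP_Psi ?Psi_neq0.
  by split=> //; rewrite ?wx ?wP ?wy ?ltxx ?mul0rn ?oppr0.
have wf := f_reg plw ne.
have vx : veq w (w x) x by split.
have vy : veq w (w y) y by split.
have vz : veq w (3 * w y - w x) (zf x y).
  rewrite mulr_natl; exact: (veqM plw (veqX plw 3 vy) (veqV plw vx)).
have wh k : vge w k x -> vge w k (zf x y) -> vge w k 1 -> vge w k y -> k <= w h.
  move=> kx kz k1 ky; have : vge w k h.
    apply: (vgeB plw); first by apply: (vgeD plw) => //; apply: (vgeD plw).
    by rewrite -(add0r k); apply: (vgeM plw) => //; apply: (vge_nat plw 3).
  by case=> // /eqP; rewrite (negPf h0).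
have wx1 k : vge w k x -> vge w k 1 -> k <= w (x - 1).
  by move=> kx k1; case: (vgeB plw kx k1) => // /eqP; rewrite (negPf x10).
have Mq : q = (3 * m.-1 + 2)%N by clear -Hm; lia.
rewrite (place_Psi plw); split=> [Hx|Hx|Hx|_ Hx Hy].
- have Hy := cx0 Hx.
  have H1 : 0 <= w h.
    apply: wh; [by right; rewrite Hx | | exact: (vge1 plw) | by right].
    by apply: vgeW (veq_vge vz); rewrite Hx; lia.
  have H2 : 0 <= w (x - 1) by apply: wx1; [right; rewrite Hx | apply: (vge1 plw)].
  rewrite Hx mul0rn; have : 0 <= w h *+ m.-1 by rewrite mulrn_wge0.
  by move: (w h *+ _) (w y *+ q) => a b; lia.
- have E := cx1 Hx.
  have Hy : 0 < w y by lia.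
  have H1 : 0 <= w h.
    apply: wh; [by right; rewrite ltW | | exact: (vge1 plw) | by right; rewrite ltW].
    by apply: vgeW (veq_vge vz); lia.
  have H2 : 0 <= w (x - 1) by apply: wx1; [right; rewrite ltW | apply: (vge1 plw)].
  have : 0 <= w h *+ m.-1 by rewrite mulrn_wge0.
  rewrite -E [in w y *+ q]Mq mulrnDr mulrnA !mulr_natl.
  by move: (w h *+ _) (w y *+ 3 *+ _) => a b; lia.
- have E := cx2 Hx.
  have H1 : w x <= w h.
    apply: wh; first exact: veq_vge.
    + by apply: vgeW (veq_vge vz); lia.
    + by apply: vgeW (vge1 plw); apply: ltW.
    + by apply: vgeW (veq_vge vy); lia.
  have H2 : w x <= w (x - 1).
    by apply: wx1; [apply: veq_vge | apply: vgeW (vge1 plw); apply: ltW].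
  have : w x *+ m.-1 <= w h *+ m.-1 by rewrite lerMn2r H1 orbT.
  rewrite [in w y *+ q]Mq mulrnDr mulrnA.
  have -> : w y *+ 3 = w x + w x by rewrite -mulr_natl E; lia.
  rewrite mulrnDl; move: (w h *+ _) (w x *+ _) => a b; lia.
- have H1 : 0 <= w h.
    apply: wh; [by right; rewrite Hx | | exact: (vge1 plw) | by right; rewrite Hy].
    by apply: vgeW (veq_vge vz); rewrite Hx Hy; lia.
  rewrite Hx Hy !mul0rn; have : 0 <= w h *+ m.-1 by rewrite mulrn_wge0.
  by move: (w h *+ _) => a; lia.
Qed.

(** Since [q + 1 = 3 m], the coordinates [1 / x] and [y / x] again satisfy a superelliptic equation;
    a place over the polynomial [X] in [1 / x] is wanted. *)
Lemma exists_infinite_place : exists w, is_place iota w /\ w x < 0.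
Proof.
(* The reciprocal polynomial transfers transcendence from [x] to [x^-1]. *)
have ev'E g : (map_poly iota g).[x^-1] * x ^+ (size g).-1 =
    evx (\poly_(i < (size g).-1.+1) g`_((size g).-1 - i)%N).
  rewrite (@horner_coef_wide _ (size g).-1.+1 (map_poly iota g)); last first.
    by rewrite size_map_poly leqSpred.
  rewrite (@horner_coef_wide _ (size g).-1.+1); last first.
    by rewrite (leq_trans (size_poly _ _)) // size_poly.
  rewrite mulr_suml.
  rewrite (reindex_inj rev_ord_inj); apply: eq_bigr => i _ /=.
  have le_i : (i <= (size g).-1)%N by rewrite -ltnS.
  rewrite !coef_map coef_poly ltn_ord /= subSS -mulrA; congr (_ * _).
  rewrite exprVn; apply: (mulfI (expf_neq0 ((size g).-1 - i) x0)).
  by rewrite mulrA divff ?expf_neq0 // mul1r -exprD subnK.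
have tr' g : g != 0 -> (map_poly iota g).[x^-1] != 0.
  move=> g0; suff : (map_poly iota g).[x^-1] * x ^+ (size g).-1 != 0.
    by rewrite mulf_eq0 negb_or => /andP[].
  rewrite ev'E; apply: tr; apply/eqP => /(congr1 (fun p : {poly F} => p`_0)).
  by rewrite coef_poly coef0 subn0 /=; apply/eqP; rewrite -lead_coefE lead_coef_eq0.
have gen' : generated iota x^-1 (y / x).
  have Hx : in_frac iota x^-1 (y / x) x.
    by rewrite -[X in in_frac _ _ _ X]invrK; apply: in_fracV; apply: in_frac_x.
  apply: (generated_change gen) => //.
  rewrite -[X in in_frac _ _ _ X](divfK x0); apply: in_fracM => //; exact: in_frac_y.
have eqn' : (y / x) ^+ q.+1 = (map_poly iota (- (om ^+ 2 *: 'X^m + om *: 'X^(2 * m)))).[x^-1].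
  rewrite rmorphN rmorphD /= !map_polyZ /= !map_polyXn hornerN hornerD !hornerZ !hornerXn.
  rewrite expr_div_n (eqnE eqn) -Hm rmorphXn !exprVn.
  have xm : x ^+ m != 0 by rewrite expf_neq0.
  rewrite !(mulnC _ m) !exprM; move: (x ^+ m) xm => t t0.
  by field.
have [w [plw wx]] := exists_place tr' (generated_dep gen' (ltn0Sn q) eqn') (irredp_XsubC 0).
exists w; split=> //; move: wx; rewrite subr0 map_polyX hornerX (placeV plw) //.
by rewrite oppr_gt0.
Qed.

Lemma gap_absurd : False.
Proof.
have [pi [g [irr_pi c_pi pi_g]]] := curve_poly_branch om0 m0.
have zn i : (zeta ^+ i) ^+ q.+1 = 1 by rewrite exprAC (prim_expr_order prim_zeta) expr1n.
have [s Hs] := choice (fun i => exists_twist tr gen (ltn0Sn q) eqn irr_pi c_pi pi_g (zn i)).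
have plc w i : is_place iota w -> is_place iota (w \o s i).
  exact: (twist_place tr gen (ltn0Sn q) eqn irr_pi c_pi pi_g (zn i) (Hs i)).
have sx i : s i x = x := twist_x (Hs i).
have sy i : s i y = iota (zeta ^+ i) * y := twist_y (Hs i).
have zi0 i : zeta ^+ i != 0.
  by apply: contra_eq_neq (zn i) => ->; rewrite expr0n eq_sym oner_neq0.
have wsy w i : is_place iota w -> w (s i y) = w y.
  by move=> plw; rewrite sy (placeM plw) ?fmorph_eq0 // (place_iota plw) // add0r.
pose T : K := \sum_(i < q.+1) s i Psi.
have s0 : s 0%N Psi = Psi.
  have [p [r [r0 ->]]] := gen Psi; rewrite (Hs 0%N) //.
  by rewrite expr0 rmorph1 !mul1r.
(* The term of index 0 is a unit at [P]. The others have at [P] the value of [Psi] at a conjugate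
   place, which is not [P], and there [Psi] vanishes along with [x - 1]. *)
have T0 : T != 0.
  suff [] : veq vP 0 T by [].
  rewrite /T big_ord_recl s0; apply: (veqD plP); first by split; [apply: Psi_neq0 | apply: vP_Psi].
  rewrite add0r; apply: (vge_sum plP) => i _; rewrite lift0.
  have ple := plc vP i.+1 plP.
  have [_ wx] := vx plP cP; have [_ wy] := vy plP cP.
  have ne : ~ same_place vP (vP \o s i.+1).
    (* This [u] is a unit at [P], but its image is a multiple of [y - 1]. *)
    move=> same; pose u := y - iota (zeta ^+ i.+1).
    have vu : veq vP 0 u.
      rewrite /u (_ : y - _ = (1 - iota (zeta ^+ i.+1)) + (y - 1)); last by ring.
      apply: (veqD plP); last by rewrite add0r; case: cP.
      rewrite -(rmorph1 iota) -rmorphB; apply: (veq_iota plP).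
      rewrite subr_eq0 eq_sym -(prim_order_dvd prim_zeta).
      by apply/negP => /(dvdn_leq (ltn0Sn i)); rewrite ltnS leqNgt ltn_ord.
    have su : s i.+1 u = iota (zeta ^+ i.+1) * (y - 1).
      rewrite (twistB tr gen (ltn0Sn q) eqn irr_pi c_pi pi_g (zn i.+1) (Hs i.+1)).
      by rewrite sy (twist_iota (Hs i.+1)); ring.
    have [u0 vu0] := vu; have := same u u0; rewrite vu0 /= su.
    have su0 := twist_neq0 gen (Hs i.+1) u0.
    have : vge vP 1 (s i.+1 u).
      rewrite su -(add0r 1); apply: (vgeM plP); last by case: cP.
      exact: (vge_iota plP).
    by case=> [/eqP|]; [rewrite (negPf su0) | rewrite su => le1 E; rewrite -E in le1].
  have [_ _ _ /(_ ne)] := Psi_bounds ple; rewrite /= sx wsy // => /(_ wx wy) le.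
  right; apply: le_trans le.
  rewrite (twistB tr gen (ltn0Sn q) eqn irr_pi c_pi pi_g (zn i.+1) (Hs i.+1)) sx (twist1 (Hs i.+1)).
  by have [_ ->] := vx1 q0 Hom tr gen eqn plP cP.
have boundT w : is_place iota w -> [/\ w x = 0 -> - (w y *+ q) <= w T,
    0 < w x -> - (2 * w y) <= w T & w x < 0 -> 0 < w T].
  move=> plw.
  have H k : (forall i, k <= w (s i Psi)) -> k <= w T.
    move=> Hk; have : vge w k T by apply: (vge_sum plw) => i _; right.
    by case=> // /eqP; rewrite (negPf T0).
  split=> Hx; last (rewrite gtz0_ge1); apply: H => i; have := Psi_bounds (plc w i plw);
    rewrite /= sx wsy // => -[H1 H2 H3 _].
  - exact: H1.
  - exact: H2.
  - by rewrite -gtz0_ge1; apply: H3.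
have [N [D [N0 D0 TE copND]]] : exists N D : {poly F}, [/\ N != 0, D != 0, T = evx N / evx D & coprimep N D].
  have [P [D [D0 PsiE]]] := clear_denominator tr gen (ltn0Sn q) eqn Psi.
  have [N HN] := trace_poly (ltn0Sn q) eqn prim_zeta P.
  have TE : T = evx N / evx D.
    rewrite -HN mulr_suml; apply: eq_bigr => i _.
    have := Hs i P D%:P; rewrite !ev2C -PsiE => ->; rewrite ?ev2C //; exact: tr.
  have N0 : N != 0 by apply: contra_neq T0 => N0; rewrite TE N0 rmorph0 horner0 mul0r.
  have G0 : gcdp N D != 0 by rewrite gcdp_eq0 negb_and N0.
  have EN := divpK (dvdp_gcdl N D); have ED := divpK (dvdp_gcdr N D).
  exists (N %/ gcdp N D), (D %/ gcdp N D); split.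
  - by apply: contra_neq N0 => E; rewrite -EN E mul0r.
  - by apply: contra_neq D0 => E; rewrite -ED E mul0r.
  - rewrite TE -[in LHS]EN -[in X in _ / X = _]ED !rmorphM !hornerM -mulf_div divff ?mulr1 //.
    exact: tr.
  - by rewrite coprimep_div_gcd // N0.
(* With a constant denominator [T] is a nonzero polynomial in [x], which cannot vanish at
   infinity. *)
have [D1|D1] := leqP (size D) 1.
  have [d dE] : exists d, D = d%:P by exists D`_0; apply: size1_polyC.
  have d0 : d != 0 by move: D0; rewrite dE polyC_eq0.
  have [w [plw wx]] := exists_infinite_place.
  have [_ _ /(_ wx)] := boundT w plw.
  have [_ wN] := place_pole_poly plw x0 wx N0.
  rewrite TE dE map_polyC hornerC (placeM plw) ?invr_eq0 ?fmorph_eq0 ?tr //.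
  rewrite (placeV plw) ?fmorph_eq0 // (place_iota plw) // subr0 wN ltNge.
  by rewrite mulrn_wle0 // ltW.
have [rho [irr_rho /dvdpP[D2 DE]]] := exists_irreducible_factor D1.
have rho0 := irredp_neq0 irr_rho; have erho0 := tr rho0.
have [w [plw wrho]] := exists_place tr (generated_dep gen (ltn0Sn q) eqn) irr_rho.
have Sx : vge w 0 x := place_zero_poly plw erho0 wrho.
have wx : 0 <= w x by case: Sx => // /eqP; rewrite (negPf x0).
have D20 : D2 != 0 by apply: contra_neq D0 => E; rewrite DE E mul0r.
have wD2 : 0 <= w (evx D2).
  have : valring w (evx D2).
    by apply: (S_evx (vring_valring plw)) => // c; apply: (vge_iota plw).
  by case=> // /eqP; rewrite (negPf (tr D20)).
have rhoN : ~~ (rho %| N).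
  apply/negP => dN; have : rho %| gcdp N D by rewrite dvdp_gcd dN DE dvdp_mulIr.
  rewrite (eqp_dvdr _ (_ : gcdp N D %= 1)); first exact/negP/irreducible_dvd1.
  by rewrite gcdp_eqp1.
have [_ wN] := place_irreducible_poly plw irr_rho erho0 wrho rhoN.
have wT : w T <= - w (evx rho).
  rewrite TE (placeM plw) ?invr_eq0 ?tr // (placeV plw) ?tr // wN add0r DE rmorphM hornerM.
  by rewrite (placeM plw) ?tr // lerN2 lerDr.
have [B1 B2 _] := boundT w plw; have [C1 C2 _] := place_cases plw.
(* The pole of [T] over [rho] has order at least [w(rho)]. This is positive where [x] and [y] are
   units, [(q + 1) w(y)] where only [y] vanishes, and [3 w(y)] at a zero of [x]; each exceeds what
   [boundT] allows. *)
move: wx; rewrite le_eqVlt => /predU1P[/esym wx|wx].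
  have := C1 wx; rewrite le_eqVlt => /predU1P[/esym wy|wy].
    have := B1 wx; rewrite wy mul0rn oppr0 => le0.
    by have := le_trans le0 wT; rewrite oppr_ge0 leNgt wrho.
  have wb := place_y plw; rewrite wx mul0rn addr0 in wb.
  have [/dvdpP[g2 E2]|nd] := boolP (rho %| branch_poly om m); last first.
    have [_ E] := place_irreducible_poly plw irr_rho erho0 wrho nd.
    by move: wb; rewrite /bx E => /eqP; rewrite mulrn_eq0 /= gt_eqF.
  rewrite mulrC in E2; have nd2 := branch_simple m0 irr_rho E2.
  have [_ Eg2] := place_irreducible_poly plw irr_rho erho0 wrho nd2.
  have g20 : g2 != 0 by apply: contraNneq nd2 => ->; apply: dvdp0.
  move: wb; rewrite /bx E2 rmorphM hornerM (placeM plw) ?tr // Eg2 addr0 => wb.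
  have := le_trans (B1 wx) wT; rewrite -wb lerN2 mulrSr gerDl => le.
  by move: wy; rewrite ltNge le.
have [dX|nd] := boolP (rho %| 'X); last first.
  have [_] := place_irreducible_poly plw irr_rho erho0 wrho nd.
  by rewrite map_polyX hornerX => E; move: wx; rewrite E ltxx.
have rho1 : size rho != 1%N by rewrite gtn_eqF // irr_rho.1.
have /eqpP[[c1 c2] /= /andP[c10 c20] E] : rho %= 'X.
  by have := (irredp_XsubC (0 : F)).2 rho rho1; rewrite subr0; apply.
have wE : w (evx rho) = w x.
  have := congr1 (fun p => w (evx p)) E; rewrite !map_polyZ /= !hornerZ map_polyX hornerX.
  by rewrite !(placeM plw) ?fmorph_eq0 // !(place_iota plw) // !add0r.
have := le_trans (B2 wx) wT; have := C2 wx; rewrite wE.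
by move: wx; clear; move: (w y) (w x) => a b; lia.
Qed.

End Gap.

(** * The semigroup *)

Section WeierstrassSemigroup.
Variables (F K : fieldType) (iota : {rmorphism F -> K}) (vP : K -> int).
Hypothesis plP : is_place iota vP.
Local Notation wsg := (in_weierstrass_semigroup iota vP).

Lemma wsg0 : wsg 0.
Proof.
by exists 1; split=> [||w plw _]; rewrite ?oner_neq0 ?(place1 plP) ?oppr0 // (place1 plw).
Qed.

Lemma wsgD n k : wsg n -> wsg k -> wsg (n + k).
Proof.
move=> [f [f0 vf rf]] [g [g0 vg rg]]; exists (f * g); split.
- by rewrite mulf_neq0.
- by rewrite (placeM plP) // vf vg PoszD opprD.
- by move=> w plw ne; rewrite (placeM plw) // addr_ge0 //; [apply: rf | apply: rg].
Qed.

Lemma wsgM c n : wsg n -> wsg (c * n).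
Proof.
by move=> Hn; elim: c => [|c IHc]; [rewrite mul0n; apply: wsg0 | rewrite mulSn; apply: wsgD].
Qed.

Lemma wsg_veq (n : nat) f : veq vP (- n%:Z) f ->
  (forall w, is_place iota w -> ~ same_place vP w -> vge w 0 f) -> wsg n.
Proof.
move=> [f0 vf] rf; exists f; split=> // w plw ne.
by case: (rf w plw ne) => // /eqP; rewrite (negPf f0).
Qed.

Lemma in_semigroup_wsg gens n : {in gens, forall g, wsg g} -> in_semigroup gens n -> wsg n.
Proof.
move=> Hg [c ->]; elim/big_ind: _ => [||i _]; [exact: wsg0 | exact: wsgD |].
by apply: wsgM; apply: Hg; apply: mem_nth.
Qed.

End WeierstrassSemigroup.

(** * Symmetry of the generated numerical semigroup *)

Section NumericalSemigroup.
Local Open Scope nat_scope.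
Variable gens : seq nat.

Lemma in_semigroupD n k : in_semigroup gens n -> in_semigroup gens k ->
  in_semigroup gens (n + k).
Proof.
move=> [c ->] [d ->]; exists (fun i => c i + d i); rewrite -big_split /=.
by apply: eq_bigr => i _; rewrite mulnDl.
Qed.

Lemma in_semigroup0 : in_semigroup gens 0.
Proof. by exists (fun=> 0); rewrite big1. Qed.

Lemma in_semigroup_gen g : g \in gens -> in_semigroup gens g.
Proof.
move=> Hg; have Hi : index g gens < size gens by rewrite index_mem.
exists (fun i => (i == index g gens) : nat); rewrite (bigD1 (Ordinal Hi)) //= eqxx mul1n nth_index //.
rewrite big1 ?addn0 // => i ne; case: eqP => // E; case/eqP: ne; exact: val_inj.
Qed.

Variables (q m : nat).
Hypotheses (Hm : 3 * m = q.+1) (m2 : 2 <= m).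
Hypotheses (g0 : in_semigroup gens q.+1) (g1 : in_semigroup gens q).
Hypothesis g2 : forall i, i < m.-1 -> in_semigroup gens ((q - 1) + i * (q - 2)).

(* [attained d s]: the semigroup contains [d (q + 1) - s], the pole order at [P] of
   [f / h ^ d] for a form [f] of degree [d] vanishing to order [s] *)
Definition attained d s := exists n, in_semigroup gens n /\ n + s = d * q.+1.

Lemma attainedD d s d' s' : attained d s -> attained d' s' -> attained (d + d') (s + s').
Proof.
move=> [n [Hn En]] [k [Hk Ek]]; exists (n + k); split; first exact: in_semigroupD.
by rewrite addnACA En Ek mulnDl.
Qed.

Lemma attained10 : attained 1 0.
Proof. by exists q.+1; rewrite addn0 mul1n. Qed.

Lemma attained11 : attained 1 1.
Proof. by exists q; rewrite addn1 mul1n. Qed.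

Lemma attained_psi d : d < m.-1 -> attained d.+1 (3 * d + 2).
Proof.
move=> Hd; exists ((q - 1) + d * (q - 2)); split; first exact: g2.
have [k ->] : exists k, q = k.+2 by exists (q - 2); lia.
by rewrite !subSS !subn0 mulSn !mulnS; lia.
Qed.

(** Each further degree adds three orders, that of [psi d] increased by the order 0, 1 or 2 of a
    linear form. *)
Lemma attained_low d s : d < m -> s <= 3 * d + 1 -> attained d.+1 s.
Proof.
elim: d s => [|d IHd] s lt_dm le_s.
  by case: s le_s => [|[|s]] //; [move=> _; apply: attained10 | move=> _; apply: attained11].
have P1 : attained d.+1 (3 * d + 2) by apply: attained_psi; lia.
have [le|gt] := leqP s (3 * d + 1).
  by rewrite -[s]addn0 -addn1; apply: attainedD attained10; apply: IHd => //; lia.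
have /or3P[/eqP->|/eqP->|/eqP->] : [|| s == 3 * d + 2 + 0, s == 3 * d + 2 + 1 |
    s == 3 * d + 2 + 2] by lia.
- by rewrite -addn1; apply: attainedD attained10.
- by rewrite -addn1; apply: attainedD attained11.
- rewrite -[d.+2]addn1; apply: attainedD => //.
  by apply: (@attained_psi 0); lia.
Qed.

(** In degree [m + 1] only [s = q = 3 m - 1] goes beyond [attained_low]; it splits as
    [(3 (m - 2) + 2) + 1 + 2]. *)
Lemma attained_high d s : m < d -> s <= q -> attained d s.
Proof.
elim: d => // d IHd; rewrite ltnS leq_eqVlt => /predU1P[<- le_s|lt_md le_s]; last first.
  by rewrite -[s]addn0 -addn1; apply: attainedD attained10; apply: IHd.
have [le|gt] := leqP s (3 * m.-1 + 1).
  rewrite -[s]addn0 -addn1; apply: attainedD attained10.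
  by rewrite -(prednK (n := m)); [apply: attained_low; lia | lia].
have -> : s = 3 * (m - 2) + 2 + 1 + 2 by lia.
have -> : m.+1 = (m - 2).+1 + 1 + 1 by lia.
apply: attainedD; last by apply: (@attained_psi 0); lia.
by apply: attainedD attained11; apply: attained_psi; lia.
Qed.

Lemma attained_eq d s n : attained d s -> n + s = d * q.+1 -> in_semigroup gens n.
Proof. by move=> [k [Hk Ek]] En; have -> : n = k by lia. Qed.

(** A positive value is [(d + 1) (q + 1) - s] with [0 <= s <= q]. Only [d < m] and [s >= 3 d + 2]
    leave a doubt. If [s = 3 d + 2], the value is a generator, or the largest gap when [d = m - 1].
    Otherwise the complement is [(m - 1 - d) (q + 1) - (q - s)], where [q - s <= 3 (m - 2 - d) + 2]
    is attained. *)
Lemma semigroup_symmetric n : in_semigroup gens n \/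
  exists k, in_semigroup gens k /\ n + k = (m.-1 * q.+1).+1.
Proof.
case: n => [|n]; first by left; apply: in_semigroup0.
(* The value in question is now [n + 1]; the shift makes [s = 0] exactly at multiples of [q + 1]. *)
pose d := n %/ q.+1; pose s := q - n %% q.+1.
have En : n.+1 + s = d.+1 * q.+1.
  rewrite {1}(divn_eq n q.+1) /s /d mulSn.
  by have := ltn_pmod n (ltn0Sn q); lia.
have le_s : s <= q by rewrite leq_subr.
clearbody s d.
have [le_s1|gt_s1] := leqP s (3 * d + 1).
  have [lt_dm|le_md] := ltnP d m.
    by left; apply: attained_eq En; apply: attained_low.
  by left; apply: attained_eq En; apply: attained_high.
have [lt_md|le_dm] := ltnP m d.+1.
  by left; apply: attained_eq En; apply: attained_high.
have [Es|ns] := eqVneq s (3 * d + 2).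
  have [lt|ge] := ltnP d m.-1.
    by left; apply: attained_eq En; rewrite Es; apply: attained_psi.
  right; exists 0; split; first exact: in_semigroup0.
  have Ed : d = m.-1 by lia.
  have Eq : q = s by lia.
  by move: En; rewrite -Eq Ed mulSn; move: (m.-1 * q.+1) => X; lia.
have att : attained (m.-1 - d.+1).+1 (q - s).
  have [E|nE] := eqVneq (q - s) (3 * (m.-1 - d.+1) + 2).
    by rewrite E; apply: attained_psi; lia.
  by apply: attained_low; lia.
have [k [Hk Ek]] := att; right; exists k; split=> //.
have Em : m.-1 = (m.-1 - d.+1) + d.+1 by clear -gt_s1 ns le_s Hm le_dm; lia.
rewrite {1}Em mulnDl; move: En Ek; rewrite [(_ - _).+1 * _]mulSn.
by move: le_s; clear; move: ((_ - _) * q.+1) (d.+1 * q.+1) => X Y; lia.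
Qed.

End NumericalSemigroup.

(** The generators are the pole orders of [R1 / h], [1 / h] and [psi i / h ^ (i + 1)]. By symmetry,
    any further pole order could be completed to the largest gap, which [gap_absurd] excludes. *)
Theorem curve_semigroup (q m : nat) (F K : fieldType) (iota : {rmorphism F -> K}) (x y : K)
    (om zeta : F) (vP : K -> int) :
  (5 <= q)%N -> (3 * m = q.+1)%N ->
  (forall u v : K, (u + v) ^+ q = u ^+ q + v ^+ q) -> q%:R = 0 :> F ->
  om ^+ 2 + om + 1 = 0 -> om ^+ q = om ^+ 2 -> q.+1.-primitive_root zeta ->
  (forall f : {poly F}, f != 0 -> (map_poly iota f).[x] != 0) ->
  generated iota x y -> y ^+ q.+1 = (map_poly iota (curve_poly m om)).[x] ->
  is_place iota vP -> centered x y vP ->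
  forall n : nat, in_weierstrass_semigroup iota vP n <-> in_semigroup (gens4p4 q) n.
Proof.
move=> q5 Hm frob q0 Hom omq prim tr gen eqn plP cP.
have mqE : mq q = m by rewrite /mq -Hm mulKn.
have vh' := vh q5 Hm frob q0 Hom omq tr gen eqn plP cP.
have reg w plw ne := @regular_coordinates q m F K iota x y om q5 Hm frob q0 Hom omq tr gen eqn vP plP cP w plw ne.
have Hgens : {in gens4p4 q, forall g, in_weierstrass_semigroup iota vP g}.
  move=> g; rewrite !inE => /or3P[/eqP->|/eqP->|/mapP[i]].
  - apply: (wsg_veq (f := lin1 (iota om) x (zf x y) 1 / tangent x (zf x y) 1 y)).
      rewrite (_ : - q%:Z = 1 - q.+1%:R); last by rewrite natz; lia.
      by apply: (veqM plP _ (veqV plP vh')); apply: vR1 Hm q0 Hom tr gen eqn _ plP cP.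
    move=> w plw ne; have [r1 rx rz ry] := reg w plw ne.
    have [_ _ SM] := (vring_valring plw).1; have SD := ring_setD (vring_valring plw).1.
    have SW : valring w (iota om) by apply: (vge_iota plw).
    move: (tangent x (zf x y) 1 y) r1 rx rz ry => h; move: (zf x y) => z r1 rx rz ry.
    rewrite (_ : _ / _ = x / h + iota om ^+ 2 * (z / h) + iota om * (1 / h)); last first.
      by rewrite /lin1; ring.
    by apply: (SD); [apply: (SD) => //; apply: (SM) => //; rewrite expr2|]; apply: (SM).
  - apply: (wsg_veq (f := 1 / tangent x (zf x y) 1 y)).
      rewrite (_ : - q.+1%:Z = 0 - q.+1%:R); last by rewrite natz; lia.
      exact: (veqM plP (veq1 plP) (veqV plP vh')).
    by move=> w plw ne; have [] := reg w plw ne.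
  rewrite mem_iota add0n mqE => /andP[_ lt_im] ->.
  apply: (wsg_veq (f := psi iota x y om i / tangent x (zf x y) 1 y ^+ i.+1)).
    have [|vpsi _] := v_psi q5 Hm frob q0 Hom omq tr gen eqn plP cP (i := i); first by lia.
    rewrite (_ : - _ = (3 * i + 2)%:R - q.+1%:R *+ i.+1).
      exact: (veqM plP vpsi (veqV plP (veqX plP _ vh'))).
    rewrite -mulrnA !natz mulnS; have [k ->] : exists k, q = k.+2 by exists (q - 2)%N; lia.
    by rewrite !subSS !subn0 !mulSn; lia.
  move=> w plw ne; exact: (regular_psi q5 Hm frob q0 Hom omq tr gen eqn plP cP i plw ne).
move=> n; split; last exact: in_semigroup_wsg.
move=> Hn; have [||||//|[k [Hk Ek]]] := @semigroup_symmetric (gens4p4 q) q m Hm _ _ _ _ n.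
- by lia.
- by apply: in_semigroup_gen; rewrite !inE eqxx orbT.
- by apply: in_semigroup_gen; rewrite !inE eqxx.
- move=> i lt_im; apply: in_semigroup_gen; rewrite !inE; apply/or3P/Or33/mapP; exists i => //.
  by rewrite mem_iota add0n mqE subn1.
have [f [f0 vf rf]] := wsgD plP Hn (in_semigroup_wsg plP Hgens Hk).
rewrite Ek in vf; exfalso.
exact: (gap_absurd q5 Hm frob q0 Hom omq prim tr gen eqn plP cP f0 rf vf).
Qed.

(** The multiplicative group is cyclic of order [(q - 1) (q + 1)]. *)
Lemma exists_primitive_root (F : finFieldType) (q : nat) : (0 < q)%N -> #|F| = (q ^ 2)%N ->
  exists zeta : F, q.+1.-primitive_root zeta.
Proof.
move=> q_gt0 cardF; pose n := #|F|.-1.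
have n_gt0 : (0 < n)%N by rewrite /n -(cardC1 (0 : F)); apply/card_gt0P; exists 1; rewrite !inE oner_neq0.
have cardn : #|F| = n.+1 by rewrite /n prednK //; apply/card_gt0P; exists 0.
have [z prim_z] : exists z : F, n.-primitive_root z.
  suff /hasP[z _ prim_z] : has n.-primitive_root (enum (predC1 (0 : F))) by exists z.
  apply: has_prim_root => //; last by rewrite -cardE cardC1.
  - apply/allP => c; rewrite mem_enum !inE => c0; rewrite unity_rootE.
    by apply/eqP/(mulfI c0); rewrite -exprS -cardn expf_card mulr1.
  - exact: enum_uniq.
have dvd : (q.+1 %| n)%N; last by exists (z ^+ (n %/ q.+1)); exact: (@dvdn_prim_root F n z prim_z q.+1 dvd).
by rewrite /n cardF -subn1 -[X in (_ - X)%N](exp1n 2) subn_sqr addn1 dvdn_mull.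
Qed.

Theorem theorem4p4 (q : nat) (F : finFieldType) (K : fieldType)
  (iota : {rmorphism F -> K}) (x y : K) (a b : F) (vP : K -> int) :
  (5 <= q)%N ->
  (exists p k : nat, prime p /\ q = (p ^ k)%N) ->
  (q %% 3 = 2)%N ->
  #|F| = (q ^ 2)%N ->
  curve_function_field iota q x y ->
  a != 0 ->
  b ^+ q.+1 + a ^+ (2 * mq q) + a ^+ mq q = 0 ->
  ~ (b = 0 /\ a ^+ mq q + 1 = 0) ->
  (let alpha := a ^+ mq q / (1 + a ^+ mq q) in alpha ^+ 2 - alpha + 1 = 0) ->
  is_place iota vP ->
  0 < vP (x - iota a) ->
  0 < vP (y - iota b) ->
  forall n : nat, in_weierstrass_semigroup iota vP n <-> in_semigroup (gens4p4 q) n.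
Proof.
move=> q5 [p [k [p_pr qE]]] q3 cardF [tr eqn gen] a0 eqab _ /= Halpha plP vxa vyb.
set m := mq q in eqab Halpha.
have Hm : (3 * m = q.+1)%N by rewrite /m /mq; lia.
have k_gt0 : (0 < k)%N by case: k qE => // E; move: q5; rewrite E.
have charF : p \in [pchar F].
  by apply: (@card_finPcharP F p (k * 2)); rewrite // cardF qE expnM.
have charK : p \in [pchar K] by rewrite (fmorph_pchar iota).
have frob (u v : K) : (u + v) ^+ q = u ^+ q + v ^+ q.
  apply: exprDn_pchar; rewrite qE (eq_pnat _ (pcharf_eq charK)); by rewrite pnatX pnat_id.
have q0 : q%:R = 0 :> F by rewrite qE natrX (pcharf0 charF) expr0n gtn_eqF.
set A := a ^+ m in Halpha *.
(* As [0^-1 = 0], the opposite would make [alpha] zero and its equation [1 = 0]. *)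
have A1 : 1 + A != 0.
  apply/eqP => E; move/eqP: Halpha; rewrite E invr0 mulr0 expr0n /= subr0 add0r.
  by rewrite oner_eq0.
have HA : A ^+ 2 + A + 1 = 0.
  transitivity (((A / (1 + A)) ^+ 2 - A / (1 + A) + 1) * (1 + A) ^+ 2); last by rewrite Halpha mul0r.
  by field.
have A3 : A ^+ 3 = 1.
  have -> : A ^+ 3 = 1 + (A ^+ 2 + A + 1) * (A - 1) by ring.
  by rewrite HA mul0r addr0.
have Aq : A ^+ q = A ^+ 2.
  have -> : q = (3 * m.-1 + 2)%N by lia.
  by rewrite exprD exprM A3 expr1n mul1r.
(* Since [A ^ 2 + A = -1], this is the curve equation at [(a, b)]; scaling [y] by [b] therefore
   leaves [y ^ (q + 1)] unchanged. *)
have bq : b ^+ q.+1 = 1.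
  have : b ^+ q.+1 + (A ^+ 2 + A + 1) - 1 = 0 by rewrite -[RHS]eqab mulnC exprM -/A; ring.
  by rewrite HA addr0 => /eqP; rewrite subr_eq0 => /eqP.
have b0 : b != 0 by apply: contra_eq_neq bq => ->; rewrite expr0n eq_sym oner_neq0.
have ia0 : iota a != 0 by rewrite fmorph_eq0.
have ib0 : iota b != 0 by rewrite fmorph_eq0.
have [zeta prim] := exists_primitive_root (ltnW (ltnW (ltnW (ltnW q5)))) cardF.
apply: (@curve_semigroup q m F K iota (x / iota a) (y / iota b) A zeta vP) => //.
(* Transcendence of [x / a]: the polynomial [f(X / a)] vanishes at [x], and substituting [a X]
   recovers [f]. *)
- move=> f; apply: contra_neq => f_root.
  have E : f \Po (a^-1 *: 'X) = 0.
    apply: tr; rewrite map_comp_poly horner_comp map_polyZ /= map_polyX hornerZ hornerX.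
    by rewrite fmorphV mulrC.
  have : (f \Po (a^-1 *: 'X)) \Po (a *: 'X) = f.
    by rewrite -comp_polyA comp_polyZ comp_polyX scalerA mulVf // scale1r comp_polyXr.
  by rewrite E comp_poly0.
- apply: (generated_change gen).
    rewrite -[X in in_frac _ _ _ X](divfK ia0); apply: in_fracM; first exact: in_frac_x.
    exact: in_frac_iota.
  rewrite -[X in in_frac _ _ _ X](divfK ib0); apply: in_fracM; first exact: in_frac_y.
  exact: in_frac_iota.
- rewrite /curve_poly rmorphN rmorphD /= !map_polyZ /= !map_polyXn hornerN hornerD !hornerZ !hornerXn.
  rewrite expr_div_n -rmorphXn bq rmorph1 divr1.
  have -> : y ^+ q.+1 = - (x ^+ (2 * m) + x ^+ m).
    by apply/eqP; rewrite -addr_eq0 addrA; apply/eqP.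
  have A2 : A ^+ 2 = a ^+ (2 * m) by rewrite -exprM mulnC.
  have div e : iota (a ^+ e) * (x / iota a) ^+ e = x ^+ e.
    by rewrite expr_div_n -rmorphXn mulrC divfK // fmorph_eq0 expf_neq0.
  by rewrite A2 !div.
- have cent u c : c != 0 -> 0 < vP (u - iota c) -> vge vP 1 (u / iota c - 1).
    move=> c0 vu; rewrite (_ : u / iota c - 1 = (u - iota c) * iota c^-1).
      by rewrite -(addr0 1); apply: (vgeM plP); [right; rewrite -gtz0_ge1 | apply: (vge_iota plP)].
    by rewrite fmorphV mulrBl divff // fmorph_eq0.
  by split; apply: cent.
Qed.
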